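(* Assume that for every point $(x_0,p_0,p_0')\in U$ the Cauchy problem $u^A_\alpha=F^A_\alpha(x^i,u^B,u^B_\Gamma)$, $u^A(x^\Lambda,x_0^\alpha)=a^A(x^\Lambda)$ is approximately solvable for every initial data at $(x_0,p_0,p_0')$. Let $l\ge k$, let $z_0=((x^i)_0,(p^A)_0,(p^A_i)_0)$ with $((x^i)_0,(p^A)_0,(p^A_\Lambda)_0)\in U$ and $(p^A_\alpha)_0=F^A_\alpha((x^i)_0,(p^B)_0,(p^B_\Lambda)_0)$, and let $E_0\subset T_{z_0}\mathbb{R}^{n+m+nm}$ be an $l$-dimensional integral element of $\mathcal{I}$ having a basis of the form $\frac{\partial}{\partial x^a}+(c^A_a)_0\frac{\partial}{\partial p^A}+(c^A_{aj})_0\frac{\partial}{\partial p^A_j}$, $a=1,\dots,l$. Then every $l$-dimensional integral element $E\subset T_z\mathbb{R}^{n+m+nm}$ of $\mathcal{I}$ with $(z,E)$ sufficiently close to $(z_0,E_0)$ in $X_l$ is Kähler regular.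
   Context: Let $1\le k<n$, $m\ge1$; indices $i,j\in\{1,\dots,n\}$, $\Lambda,\Gamma\in\{1,\dots,k\}$, $\alpha\in\{k+1,\dots,n\}$, $A,B\in\{1,\dots,m\}$, $a,a'\in\{1,\dots,l\}$, $b\in\{l+1,\dots,n\}$; repeated upper/lower indices summed. $F^A_\alpha(x^i,p^B,p^B_\Lambda)$ real-valued real-analytic on open $U\subset\mathbb{R}^n\times\mathbb{R}^m\times\mathbb{R}^{mk}$. Approximate solvability for every initial data at $(x_0,p_0,p_0')$: for every real-analytic $a^A$ near $(x_0^\Lambda)$ with $a^A(x_0^\Gamma)=p^A_0$, $a^A_\Lambda(x_0^\Gamma)=(p_0')^A_\Lambda$, there is a real-analytic $u$ near $x_0$ with $u^A_\alpha-F^A_\alpha(x^i,u^B,u^B_\Gamma)=O(|x-x_0|^2)$ and $u^A(x^1,\dots,x^k,x_0^{k+1},\dots,x_0^n)-a^A(x^\Lambda)=O(|x^\Lambda-x_0^\Lambda|^3)$. On $\mathbb{R}^n\times\mathbb{R}^m\times\mathbb{R}^{nm}$ with coordinates $z=(x^i,p^A,p^A_i)$, $\mathcal{I}$ is the exterior differential system generated by $f^A_\alpha:=p^A_\alpha-F^A_\alpha(x^i,p^B,p^B_\Gamma)$ and $\eta^A:=dp^A-p^A_idx^i$; set $\Omega^A:=dp^A_i\wedge dx^i$. An integral element at $z$ is a linear subspace of $T_z\mathbb{R}^{n+m+nm}$ on which all forms of $\mathcal{I}$ vanish (functions vanish at $z$); for an $l$-dimensional integral element $E$ with basis $e_1,\dots,e_l$,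 $H(E):=\{v:\phi(v,e_1,\dots,e_l)=0$ for all $(l+1)$-forms $\phi\in\mathcal{I}\}$. $X_l$ is the Grassmann bundle of pairs $(z,E)$ with $E$ an $l$-dimensional subspace of $T_z\mathbb{R}^{n+m+nm}$. Near $(z_0,E_0)$, each $(z,E)$ has a unique basis $\tilde e_a=\frac{\partial}{\partial x^a}+c^b_a\frac{\partial}{\partial x^b}+c^A_a\frac{\partial}{\partial p^A}+c^A_{aj}\frac{\partial}{\partial p^A_j}$, and $(z,c^b_a,c^A_a,c^A_{aj})$ are local coordinates on $X_l$. Let $\mathcal{F}$ be the family of real-analytic functions of $(z,E)$ consisting of $f^A_\alpha$, $\eta^A(\tilde e_a)$, $(df^A_\alpha)(\tilde e_a)$, $\Omega^A(\tilde e_a,\tilde e_{a'})$. A point $t_0$ is an ordinary zero of a family $\mathcal{F}$ of germs of real-analytic functions vanishing at $t_0$ if there are $f_1,\dots,f_\kappa\in\mathcal{F}$ with linearly independent differentials at $t_0$ such that the germ at $t_0$ of the common zero set of $\mathcal{F}$ equals that of $\{f_1=\dots=f_\kappa=0\}$. An $l$-dimensional integral element $E$ at $z$ (with $(z,E)$ in this chart) is Kähler ordinary if $(z,E)$ is an ordinary zero of $\mathcal{F}$, and Kähler regular if it is Kähler ordinary and $\dim H(E')$ is constant for all $l$-dimensional integral elements $E'$ at $z'$ with $(z',E')$ sufficiently close to $(z,E)$. *)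

(* Defs.v *)
From HB Require Import structures.
From mathcomp Require Import all_boot all_order all_algebra.
From mathcomp Require Import all_classical all_reals all_analysis.
Set Implicit Arguments. Unset Strict Implicit. Unset Printing Implicit Defensive.
Import Order.TTheory GRing.Theory Num.Theory.
Import numFieldNormedType.Exports.
Local Open Scope classical_set_scope.
Local Open Scope ring_scope.

(* Index types.  Indices are 0-based: x^i, i : 'I_n ;  p^A, A : 'I_m. *)
(*   Lambda-indices  (1..k in the paper)   : {i : 'I_n | i < k}       *)
(*   alpha-indices   (k+1..n in the paper) : {i : 'I_n | k <= i}      *)
(*   a-indices       (1..l in the paper)   : 'I_l  (x^a with a < l)   *)
(*   b-indices       (l+1..n in the paper) : {i : 'I_n | l <= i}      *)
Notation Lidx n k := {i : 'I_n | (i < k)%N}.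
Notation Gidx n k := {i : 'I_n | (k <= i)%N}.
Notation Bidx n l := {i : 'I_n | (l <= i)%N}.

(* coordinates (x^i, p^A, p^A_i) of R^n x R^m x R^{nm} *)
Notation Coord n m := (('I_n + 'I_m) + ('I_m * 'I_n))%type.
(* coordinates (x^i, p^B, p^B_Lambda) of the domain of F *)
Notation FCoord n m k := (('I_n + 'I_m) + ('I_m * Lidx n k))%type.
(* fibre coordinates c^b_a, c^A_a, c^A_{aj} of the chart of X_l *)
Notation ChartC n m l :=
  ((('I_l * Bidx n l) + ('I_l * 'I_m)) + ('I_l * ('I_m * 'I_n)))%type.
(* chart coordinates (z, c) on X_l *)
Notation XCoord n m l := (Coord n m + ChartC n m l)%type.
(* the family F indexes: f^A_alpha, eta^A(e_a), df^A_alpha(e_a), Omega^A(e_a,e_a') *)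
Notation FamIdx n m k l :=
  ((('I_m * Gidx n k) + ('I_m * 'I_l)) +
   ((('I_m * Gidx n k) * 'I_l) + (('I_m * 'I_l) * 'I_l)))%type.

Section Analysis.
Variable R : realType.

Definition dmax (I : finType) (x y : I -> R) : R :=
  \big[Num.max/0]_(i : I) `|x i - y i|.

Definition open_set (I : finType) (V : (I -> R) -> Prop) : Prop :=
  forall y, V y -> exists r : R, 0 < r /\ forall x, dmax x y < r -> V x.

Definition ps_partial (I : finType) (c : (I -> nat) -> R) (y x : I -> R)
    (N : nat) : R :=
  \sum_(al : {ffun I -> 'I_N.+1} | (\sum_(i : I) nat_of_ord (al i) <= N)%N)
     c (fun i => nat_of_ord (al i)) * \prod_(i : I) (x i - y i) ^+ (al i).

Definition ps_abs_partial (I : finType) (c : (I -> nat) -> R) (y x : I -> R)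
    (N : nat) : R :=
  \sum_(al : {ffun I -> 'I_N.+1} | (\sum_(i : I) nat_of_ord (al i) <= N)%N)
     `|c (fun i => nat_of_ord (al i))| * \prod_(i : I) `|x i - y i| ^+ (al i).

Definition analytic_at (I : finType) (V : (I -> R) -> Prop)
    (f : (I -> R) -> R) (y : I -> R) : Prop :=
  exists r : R, 0 < r /\ exists c : (I -> nat) -> R,
    forall x, dmax x y < r ->
      V x /\ (exists M : R, forall N, ps_abs_partial c y x N <= M) /\
      (fun N => ps_partial c y x N) @ \oo --> f x.

Definition real_analytic_on (I : finType) (V : (I -> R) -> Prop)
    (f : (I -> R) -> R) : Prop :=
  open_set V /\ forall y, V y -> analytic_at V f y.

Definition dirderiv (I : finType) (g : (I -> R) -> R) (x v : I -> R) : R :=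
  derive1 (fun t : R => g (fun i => x i + t * v i)) 0.

Definition pderiv (I : finType) (g : (I -> R) -> R) (i : I) (x : I -> R) : R :=
  dirderiv g x (fun j => if j == i then 1 else 0).

Definition lin_indep (I : finType) (d : nat) (w : 'I_d -> I -> R) : Prop :=
  forall lam : 'I_d -> R, (forall s, \sum_(j < d) lam j * w j s = 0) ->
    forall j, lam j = 0.

Definition in_span (I : finType) (d : nat) (w : 'I_d -> I -> R) (v : I -> R)
  : Prop := exists lam : 'I_d -> R, forall s, v s = \sum_(j < d) lam j * w j s.

(* two subsets of R^I have the same dimension (= max. number of linearly
   independent vectors they contain) *)
Definition has_indep (I : finType) (H : (I -> R) -> Prop) (d : nat) : Prop :=
  exists w : 'I_d -> I -> R, (forall j, H (w j)) /\ lin_indep w.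

Definition same_dim (I : finType) (H1 H2 : (I -> R) -> Prop) : Prop :=
  forall d, has_indep H1 d <-> has_indep H2 d.

End Analysis.

Section EDS.
Variables (R : realType) (n m k l : nat).
(* F^A_alpha, meaningful on the open set U *)
Variable F : 'I_m -> Gidx n k -> (FCoord n m k -> R) -> R.

Notation V := (Coord n m -> R).

Definition form (d : nat) := ('I_d -> V) -> R.

Definition upd (d : nat) (vs : 'I_d -> V) (j : 'I_d) (w : V) : 'I_d -> V :=
  fun i => if i == j then w else vs i.

Definition altform (d : nat) (phi : form d) : Prop :=
  (forall (vs : 'I_d -> V) j (a : R) (u w : V),
     phi (upd vs j (fun s => a * u s + w s)) =
     a * phi (upd vs j u) + phi (upd vs j w)) /\
  (forall (vs : 'I_d -> V) (i j : 'I_d), i != j -> vs i = vs j -> phi vs = 0).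

Definition wedge1 (d : nat) (theta : V -> R) (beta : form d) : form d.+1 :=
  fun vs => \sum_(j < d.+1) (-1) ^+ j * theta (vs j) * beta (fun i => vs (lift j i)).

Definition dx (i : 'I_n) (v : V) : R := v (inl (inl i)).
Definition dp (A : 'I_m) (v : V) : R := v (inl (inr A)).
Definition dpp (A : 'I_m) (i : 'I_n) (v : V) : R := v (inr (A, i)).

Definition zx (z : V) (i : 'I_n) : R := z (inl (inl i)).
Definition zp (z : V) (A : 'I_m) : R := z (inl (inr A)).
Definition zpp (z : V) (A : 'I_m) (i : 'I_n) : R := z (inr (A, i)).

Definition Fproj (z : V) : FCoord n m k -> R :=
  fun s => match s with
  | inl (inl i) => zx z i
  | inl (inr B) => zp z B
  | inr (B, G) => zpp z B (val G)
  end.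

Definition fz (A : 'I_m) (al : Gidx n k) (z : V) : R :=
  zpp z A (val al) - F A al (Fproj z).

Definition eta (z : V) (A : 'I_m) (v : V) : R :=
  dp A v - \sum_(i < n) zpp z A i * dx i v.
Definition df (z : V) (A : 'I_m) (al : Gidx n k) (v : V) : R :=
  dirderiv (fz A al) z v.

(* Omega^A = dp^A_i /\ dx^i  (= - d eta^A) *)
Definition Omega (A : 'I_m) (u v : V) : R :=
  \sum_(i < n) (dpp A i u * dx i v - dpp A i v * dx i u).

Definition Omega_wedge (d : nat) (A : 'I_m) (delta : form d) : form d.+2 :=
  fun vs => \sum_(i < n) wedge1 (dpp A i) (wedge1 (dx i) delta) vs.

(* Values at z of the d-forms of the differential ideal I generated by the
   f^A_alpha and eta^A, i.e. of
     g_{A alpha} f^A_alpha + alpha_{A alpha} /\ df^A_alpha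
       + beta_A /\ eta^A + delta_A /\ d eta^A
   with arbitrary coefficient forms. *)
Definition omega_part (z : V) (d : nat) : form d.+1 -> Prop :=
  match d return form d.+1 -> Prop with
  | 0 => fun r => forall vs, r vs = 0
  | d'.+1 => fun r => exists de : 'I_m -> form d',
      (forall A, altform (de A)) /\
      forall vs, r vs = \sum_(A < m) Omega_wedge A (de A) vs
  end.

Definition one_part (z : V) (d : nat) : form d -> Prop :=
  match d return form d -> Prop with
  | 0 => fun r => forall vs, r vs = 0
  | d'.+1 => fun r =>
      exists (al : 'I_m -> Gidx n k -> form d') (be : 'I_m -> form d')
             (om : form d'.+1),
      (forall A a, altform (al A a)) /\ (forall A, altform (be A)) /\
      omega_part z om /\
      forall vs, r vs =
        \sum_(A < m) \sum_(a : Gidx n k) wedge1 (df z A a) (al A a) vs +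
        \sum_(A < m) wedge1 (eta z A) (be A) vs + om vs
  end.

Definition inI (z : V) (d : nat) (phi : form d) : Prop :=
  exists (ga : 'I_m -> Gidx n k -> form d) (r : form d),
    (forall A a, altform (ga A a)) /\ one_part z r /\
    forall vs, phi vs =
      \sum_(A < m) \sum_(a : Gidx n k) fz A a z * ga A a vs + r vs.

(* E = span of the basis e is an l-dimensional integral element at z:
   all forms of I (including the functions f^A_alpha) vanish on E *)
Definition integral_element (z : V) (e : 'I_l -> V) : Prop :=
  lin_indep e /\
  forall (d : nat) (phi : form d), inI z phi ->
    forall vs : 'I_d -> V, (forall j, in_span e (vs j)) -> phi vs = 0.

Definition polar (z : V) (e : 'I_l -> V) : V -> Prop :=
  fun v => forall phi : form l.+1, inI z phi ->
    phi (fun j => match unlift ord0 j with Some i => e i | None => v end) = 0.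

Definition zof (t : XCoord n m l -> R) : V := fun s => t (inl s).

(* e~_a = d/dx^a + c^b_a d/dx^b + c^A_a d/dp^A + c^A_{aj} d/dp^A_j *)
Definition etilde (t : XCoord n m l -> R) (a : 'I_l) : V :=
  fun s => match s with
  | inl (inl i) =>
      if nat_of_ord i == nat_of_ord a then 1 else
      match (insub i : option (Bidx n l)) with
      | Some b => t (inr (inl (inl (a, b))))
      | None => 0
      end
  | inl (inr A) => t (inr (inl (inr (a, A))))
  | inr (A, j) => t (inr (inr (a, (A, j))))
  end.

Definition fam (s : FamIdx n m k l) (t : XCoord n m l -> R) : R :=
  match s with
  | inl (inl (A, al)) => fz A al (zof t)
  | inl (inr (A, a)) => eta (zof t) A (etilde t a)
  | inr (inl ((A, al), a)) => df (zof t) A al (etilde t a)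
  | inr (inr ((A, a), a')) => Omega A (etilde t a) (etilde t a')
  end.

Definition ordinary_zero (t0 : XCoord n m l -> R) : Prop :=
  (forall s, fam s t0 = 0) /\
  exists S : {set FamIdx n m k l},
    (forall lam : FamIdx n m k l -> R,
       (forall tau, \sum_(s in S) lam s * pderiv (fam s) tau t0 = 0) ->
       forall s, s \in S -> lam s = 0) /\
    exists r : R, 0 < r /\ forall t, dmax t t0 < r ->
      ((forall s, fam s t = 0) <-> (forall s, s \in S -> fam s t = 0)).

Definition kahler_ordinary (t : XCoord n m l -> R) : Prop :=
  integral_element (zof t) (etilde t) /\ ordinary_zero t.

Definition kahler_regular (t : XCoord n m l -> R) : Prop :=
  kahler_ordinary t /\
  exists r : R, 0 < r /\ forall t', dmax t' t < r ->
    integral_element (zof t') (etilde t') ->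
    same_dim (polar (zof t') (etilde t')) (polar (zof t) (etilde t)).

End EDS.

Section Cauchy.
Variables (R : realType) (n m k : nat).
Variable F : 'I_m -> Gidx n k -> (FCoord n m k -> R) -> R.

Definition Fpt (x : 'I_n -> R) (p : 'I_m -> R) (q : 'I_m -> Lidx n k -> R)
  : FCoord n m k -> R :=
  fun s => match s with
  | inl (inl i) => x i
  | inl (inr B) => p B
  | inr (B, G) => q B G
  end.

Definition approx_solvable (x0 : 'I_n -> R) (p0 : 'I_m -> R)
    (p0' : 'I_m -> Lidx n k -> R) : Prop :=
  let x0L : Lidx n k -> R := fun L => x0 (val L) in
  forall a : 'I_m -> (Lidx n k -> R) -> R,
    (exists W : (Lidx n k -> R) -> Prop, W x0L /\
       forall A, real_analytic_on W (a A)) ->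
    (forall A, a A x0L = p0 A) ->
    (forall A L, pderiv (a A) L x0L = p0' A L) ->
    exists u : 'I_m -> ('I_n -> R) -> R,
      (exists W : ('I_n -> R) -> Prop, W x0 /\
         forall A, real_analytic_on W (u A)) /\
      (exists (C r : R), 0 < r /\ forall x, dmax x x0 < r ->
         forall A (al : Gidx n k),
           `| pderiv (u A) (val al) x -
              F A al (Fpt x (fun B => u B x)
                          (fun B G => pderiv (u B) (val G) x)) |
           <= C * dmax x x0 ^+ 2) /\
      (exists (C r : R), 0 < r /\ forall y : Lidx n k -> R, dmax y x0L < r ->
         forall A,
           `| u A (fun i => match (insub i : option (Lidx n k)) with
                            | Some L => y L | None => x0 i end)
              - a A y | <= C * dmax y x0L ^+ 3).

End Cauchy.

(* Main.v *)
Require Import Defs.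
From HB Require Import structures.
From mathcomp Require Import all_boot all_order all_algebra.
From mathcomp Require Import all_classical all_reals all_analysis.
From mathcomp Require Import ring lra zify.
Set Implicit Arguments. Unset Strict Implicit. Unset Printing Implicit Defensive.
Import Order.TTheory GRing.Theory Num.Theory.
Import numFieldNormedType.Exports Defs.
Local Open Scope classical_set_scope.
Local Open Scope ring_scope.

(* Let z satisfy f(z) = 0.  Expanding the approximate solutions to second order
   shows that any symmetric array q_{Lambda Gamma} extends to a symmetric q_{ij}
   such that the vectors d/dx^i + p_i d/dp + q_ij d/dp_j span an n-dimensional
   integral element at z.  A vector w_j d/dp_j killed by all df_alpha is
   determined by the w_Lambda; hence, for c^b_a small, it is also determined by
   its contractions with the x-parts of e_1, ..., e_k.  Used twice, this lets one
   choose q so that the n-dimensional integral element contains e_1, ..., e_k,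
   and then each e_a as soon as Omega(e_a, e_Lambda) = 0 for Lambda <= k.
   So the equations f, eta(e_a), df(e_a) and Omega(e_a, e_Lambda) with
   Lambda < a, Lambda <= k, imply all the others; their differentials are
   independent, and H(E) is that n-dimensional integral element, so its
   dimension is n. *)

(** The obstacle is that solvability is given for data on the coordinate planes x^alpha = const,
    whereas the x-parts of e_1, ..., e_k in a nearby element are d/dx^a + c^b_a d/dx^b with c^b_a
    small but nonzero. No change of variables is made. The 2-jets satisfying df_alpha = 0 form an
    affine space on which restriction to the coordinate plane is onto; restriction to the span of
    the tilted x-parts is an injective linear map to arrays of the same size, so it is onto as well.
    The equations df_alpha = 0 come from moving along x_0 + t d/dx^i: the error of an approximate
    solution is O(t^2), and its coefficient of t is df_alpha on the lift of d/dx^i. The cubic error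
    allowed in the initial data is what fixes the Hessian on the coordinate plane. For the
    independence of the differentials, a linear relation is tested on directions w_j d/dp_j killed
    by the df_alpha and dual to e_1, ..., e_k. These isolate the multipliers of Omega one at a time;
    the rest of the system is triangular. *)

Section MaxDistance.
Variables (R : realType) (I : finType).
Implicit Types (x y z : I -> R) (r : R).

Lemma dmax_ge0 x y : 0 <= dmax x y.
Proof.
rewrite /dmax; elim/big_rec: _ => // i s _ hs.
by rewrite le_max hs orbT.
Qed.

Lemma le_dmax x y i : `|x i - y i| <= dmax x y.
Proof. by rewrite /dmax (bigD1 i) //= le_max lexx. Qed.

Lemma dmax_le x y r : 0 <= r -> (forall i, `|x i - y i| <= r) -> dmax x y <= r.
Proof.
move=> r0 h; rewrite /dmax; elim/big_ind: _ => // s t hs ht.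
by rewrite ge_max hs ht.
Qed.

Lemma dmax_lt x y r : 0 < r -> (forall i, `|x i - y i| < r) -> dmax x y < r.
Proof.
move=> r0 h; rewrite /dmax; elim/big_ind: _ => // s t hs ht.
by rewrite gt_max hs ht.
Qed.

Lemma dmaxxx x : dmax x x = 0.
Proof. by apply/eqP; rewrite eq_le dmax_ge0 andbT dmax_le // => i; rewrite subrr normr0. Qed.

Lemma dmax_triangle x y z : dmax x z <= dmax x y + dmax y z.
Proof.
apply: dmax_le; first by rewrite addr_ge0 ?dmax_ge0.
move=> i; rewrite -[x i](subrK (y i)) -addrA.
by apply: le_trans (ler_normD _ _) _; rewrite lerD ?le_dmax.
Qed.

End MaxDistance.

(** * Derivatives and inequalities from quadratic remainders in one variable *)

Section OneVariable.
Variable R : realType.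
Implicit Types (f : R -> R) (r C L a b : R).

Lemma derive1_of_quadratic_error f r C L : 0 < r ->
  (forall t, `|t| < r -> `|f t - f 0 - t * L| <= C * t ^+ 2) ->
  derive1 f 0 = L.
Proof.
move=> r0 hf; rewrite /derive1; apply/cvg_lim => //.
apply/cvgrPdist_le => /= e e0.
have C0 : 0 <= `|C| + 1 by rewrite addr_ge0.
have Cp : 0 < `|C| + 1 by rewrite ltr_wpDl.
near=> h.
have h0 : h != 0 by near: h; exact: nbhs_dnbhs_neq.
have hr : `|h| < r.
  by near: h; apply: dnbhs0_lt.
have he : `|h| <= e / (`|C| + 1).
  by near: h; apply: dnbhs0_le; rewrite divr_gt0.
have := hf h hr; rewrite addr0 => hh.
rewrite -[_ *: _]/(h^-1 * (f h - f 0)).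
have -> : L - h^-1 * (f h - f 0) = - (h^-1 * (f h - f 0 - h * L)).
  by field.
rewrite normrN normrM normfV ler_pdivrMl ?normr_gt0 //.
apply: le_trans hh _.
rewrite -real_normK ?num_real // expr2 mulrA mulrC ler_wpM2l //.
move: he; rewrite ler_pdivlMr // mulrC; apply: le_trans.
by rewrite ler_wpM2r // ler_wpDr // ler_norm.
Unshelve. all: end_near. Qed.

Lemma derive1_affine a b : derive1 (fun t : R => a + t * b) 0 = b.
Proof.
apply: (@derive1_of_quadratic_error _ 1 0) => // t _.
by rewrite !mul0r addr0 [a + _]addrC addrK subrr normr0.
Qed.

Lemma le_of_linear_error r C a b : 0 < r ->
  (forall t, 0 < t -> t < r -> t * a <= t * b + C * t ^+ 2) -> a <= b.
Proof.
move=> r0 h; apply/ler_addgt0Pr => e e0.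
have Cp : 0 < `|C| + 1 by rewrite ltr_wpDl.
set t := Num.min (r / 2) (e / (`|C| + 1)).
have t0 : 0 < t by rewrite lt_min !divr_gt0.
have tr : t < r.
  by rewrite gt_min; apply/orP; left; rewrite ltr_pdivrMr // mulr2n mulrDr mulr1 ltrDl.
have te : t * (`|C| + 1) <= e by rewrite -ler_pdivlMr // ge_min lexx orbT.
rewrite -(ler_pM2l t0); apply: le_trans (h t t0 tr) _.
rewrite mulrDr lerD2l expr2 mulrCA ler_pM2l // mulrC.
by apply: le_trans te; rewrite ler_pM2l // ler_wpDr // ler_norm.
Qed.

Lemma eq0_of_linear_error r C a : 0 < r ->
  (forall t, 0 < t -> t < r -> `|t * a| <= C * t ^+ 2) -> a = 0.
Proof.
move=> r0 h; apply/eqP; rewrite -normr_eq0 eq_le normr_ge0 andbT.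
apply: (@le_of_linear_error r C) => // t t0 tr.
by have := h t t0 tr; rewrite normrM (gtr0_norm t0) mulr0 add0r.
Qed.

End OneVariable.

(** * Quadratic polynomials in several variables *)

Section QuadraticFunctions.
Variables (R : realType) (I : finType).
Implicit Types (h l : I -> R) (q : I -> I -> R) (f g : (I -> R) -> R).

(** The factor 1/2 makes [l] the gradient at 0 and, for symmetric [q], makes [q] the Hessian. *)
Definition quad (c0 : R) l q h : R :=
  c0 + \sum_i l i * h i + 2^-1 * \sum_i \sum_j q i j * h i * h j.

Definition symmetric_array q := forall i j, q i j = q j i.

(** Serves to bring the degree-2 truncation of a power series to Hessian form by closure properties,
    without formulas for [l] and [q] in terms of its coefficients. *)
Definition is_quad f := exists c0 l q, symmetric_array q /\ forall h, f h = quad c0 l q h.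

Lemma is_quad_ext f g : f =1 g -> is_quad g -> is_quad f.
Proof. by move=> e [c0 [l [q [hs hq]]]]; exists c0, l, q; split=> // h; rewrite e hq. Qed.

Lemma is_quadD f g : is_quad f -> is_quad g -> is_quad (fun h => f h + g h).
Proof.
move=> [a [l [q [hs hq]]]] [a' [l' [q' [hs' hq']]]].
exists (a + a'), (fun i => l i + l' i), (fun i j => q i j + q' i j); split.
  by move=> i j; rewrite hs hs'.
move=> h; rewrite hq hq' /quad.
under [X in _ = _ + X + _]eq_bigr do rewrite mulrDl.
under [X in _ = _ + _ * X]eq_bigr do under eq_bigr do rewrite !mulrDl.
under [X in _ = _ + _ * X]eq_bigr do rewrite big_split.
by rewrite !big_split /=; ring.
Qed.

Lemma is_quadZ c f : is_quad f -> is_quad (fun h => c * f h).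
Proof.
move=> [a [l [q [hs hq]]]].
exists (c * a), (fun i => c * l i), (fun i j => c * q i j); split.
  by move=> i j; rewrite hs.
move=> h; rewrite hq /quad.
under [X in _ = _ + X + _]eq_bigr do rewrite -mulrA.
under [X in _ = _ + _ * X]eq_bigr do under eq_bigr do rewrite -2!mulrA.
under [X in _ = _ + _ * X]eq_bigr do rewrite -mulr_sumr.
rewrite -!mulr_sumr.
under [X in _ = _ + _ * (_ * X)]eq_bigr do under eq_bigr do rewrite mulrA.
by ring.
Qed.

Lemma is_quad_const c : is_quad (fun=> c).
Proof.
exists c, (fun=> 0), (fun _ _ => 0); split=> // h; rewrite /quad.
rewrite big1 => [|i _]; last by rewrite mul0r.
rewrite big1 => [|i _]; first by rewrite mulr0 !addr0.
by rewrite big1 // => j _; rewrite !mul0r.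
Qed.

Lemma is_quad_coord i0 : is_quad (fun h => h i0).
Proof.
exists 0, (fun i => (i == i0)%:R), (fun _ _ => 0); split=> // h; rewrite /quad.
rewrite (bigD1 i0) //= eqxx mul1r big1 => [|i /negbTE ->]; last by rewrite mul0r.
rewrite big1 => [|i _]; first by rewrite mulr0 !addr0 add0r.
by rewrite big1 // => j _; rewrite !mul0r.
Qed.

(** The witness is the symmetrised array. For [i0 = j0] its two terms add up to 2, so the factor 1/2
    in [quad] is right in both cases. *)
Lemma is_quad_coord2 i0 j0 : is_quad (fun h => h i0 * h j0).
Proof.
exists 0, (fun=> 0),
  (fun i j => (i == i0)%:R * (j == j0)%:R + (i == j0)%:R * (j == i0)%:R).
split=> [i j|h]; first by rewrite addrC mulrC [X in _ + X]mulrC.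
rewrite /quad.
rewrite big1 => [|i _]; last by rewrite mul0r.
have sel a b : \sum_i \sum_j (i == a)%:R * (j == b)%:R * h i * h j = h a * h b.
  rewrite (bigD1 a) //= [X in _ + X]big1 => [|i /negbTE ->]; last first.
    by rewrite big1 // => j _; rewrite !mul0r.
  rewrite (bigD1 b) //= big1 => [|j /negbTE ->]; last by rewrite mulr0 !mul0r.
  by rewrite !eqxx !mul1r !addr0.
under [X in _ = _ + _ * X]eq_bigr do under eq_bigr do rewrite !mulrDl.
under [X in _ = _ + _ * X]eq_bigr do rewrite big_split.
by rewrite big_split /= !sel; field.
Qed.

Lemma is_quad_sum (J : finType) (P : pred J) (F : J -> (I -> R) -> R) :
  (forall j, P j -> is_quad (F j)) -> is_quad (fun h => \sum_(j | P j) F j h).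
Proof.
move=> hF.
have H (s : seq J) : is_quad (fun h => \sum_(j <- s | P j) F j h).
  elim: s => [|j s IH].
    by apply: is_quad_ext (is_quad_const 0) => h; rewrite big_nil.
  case Pj : (P j).
    by apply: is_quad_ext (is_quadD (hF _ Pj) IH) => h; rewrite big_cons Pj.
  by apply: is_quad_ext IH => h; rewrite big_cons Pj.
exact: H.
Qed.

Lemma prod_exp_split (al : I -> nat) i0 h : (0 < al i0)%N ->
  \prod_i h i ^+ al i = h i0 * \prod_i h i ^+ (al i - (i == i0)).
Proof.
move=> ai; rewrite (bigD1 i0) //= [in RHS](bigD1 i0) //= mulrA eqxx subn1.
rewrite -exprS prednK //; congr (_ * _); apply: eq_bigr => i /negbTE ->.
by rewrite subn0.
Qed.

(** Variables of positive exponent are split off one at a time; each lowers the total degree by one,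
    so at most two come off. *)
Lemma is_quad_monomial (al : I -> nat) : (\sum_i al i <= 2)%N ->
  is_quad (fun h => \prod_i h i ^+ al i).
Proof.
have zero (b : I -> nat) : (forall i, b i = 0%N) -> forall h, \prod_i h i ^+ b i = 1.
  by move=> b0 h; rewrite big1 // => i _; rewrite b0.
have drop (b : I -> nat) i0 d : (0 < b i0)%N -> (\sum_i b i <= d.+1)%N ->
    (\sum_i (b i - (i == i0)) <= d)%N.
  move=> bi; rewrite (bigD1 i0) //= [in X in _ -> X](bigD1 i0) //= eqxx.
  have -> : (\sum_(i | i != i0) (b i - (i == i0)) = \sum_(i | i != i0) b i)%N.
    by apply: eq_bigr => i /negbTE ->; rewrite subn0.
  by lia.
have [i0 a0|a0] := pickP (fun i => (0 < al i)%N); last first.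
  move=> _; apply: is_quad_ext (is_quad_const 1); apply: zero => i.
  by have := a0 i; case: (al i).
move=> /(drop _ _ _ a0); set b := fun i => (al i - (i == i0))%N => hb.
have [i1 b1|b1] := pickP (fun i => (0 < b i)%N); last first.
  apply: is_quad_ext (is_quad_coord i0) => h; rewrite (prod_exp_split _ a0).
  by rewrite (zero b) ?mulr1 // => i; have := b1 i; case: (b i).
have := drop _ _ _ b1 hb; rewrite leqn0 sum_nat_eq0 => /forallP /= hz.
apply: is_quad_ext (is_quad_coord2 i0 i1) => h.
rewrite (prod_exp_split _ a0) (prod_exp_split (al := b) _ b1).
by rewrite (zero (fun i => b i - (i == i1))%N) ?mulr1 // => i; apply/eqP; exact: hz.
Qed.

End QuadraticFunctions.

(** * The tail of a power series beyond degree two *)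

Section PowerSeries.
Variables (R : realType) (I : finType).
Implicit Types (x y h k : I -> R) (c : (I -> nat) -> R).

(* The factor [e] on the left replaces [e ^ (d - 1)] on the right and makes the
   estimate stable under products of monomials. *)
Lemma monomial_lipschitz (e s : R) h k (al : I -> nat) : 0 <= e -> 0 <= s ->
  (forall i, `|h i| <= e) -> (forall i, `|k i| <= e) ->
  (forall i, `|h i - k i| <= s) ->
  e * `|\prod_i h i ^+ al i - \prod_i k i ^+ al i|
    <= (\sum_i al i)%:R * e ^+ (\sum_i al i) * s.
Proof.
move=> e0 s0 he ke hk.
pose K (X Y : R) (d : nat) := [/\ `|X| <= e ^+ d, `|Y| <= e ^+ d &
  e * `|X - Y| <= d%:R * e ^+ d * s].
have K0 : K 1 1 0%N by split; rewrite ?normr1 ?expr0 // subrr normr0 mulr0 !mul0r.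
have KM X Y d X' Y' d' : K X Y d -> K X' Y' d' -> K (X * X') (Y * Y') (d + d')%N.
  move=> [a1 a2 a3] [b1 b2 b3].
  split; rewrite ?exprD; [by rewrite normrM ler_pM|by rewrite normrM ler_pM|].
  have -> : X * X' - Y * Y' = (X - Y) * X' + Y * (X' - Y') by ring.
  apply: le_trans (_ : e * `|X - Y| * `|X'| + `|Y| * (e * `|X' - Y'|) <= _).
    rewrite [leRHS](_ : _ = e * (`|X - Y| * `|X'| + `|Y| * `|X' - Y'|)); last by ring.
    rewrite ler_wpM2l //.
    by apply: le_trans (ler_normD _ _) _; rewrite !normrM.
  have -> : (d + d')%:R * (e ^+ d * e ^+ d') * s =
     d%:R * e ^+ d * s * e ^+ d' + e ^+ d * (d'%:R * e ^+ d' * s).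
    by rewrite natrD; ring.
  by rewrite lerD // ler_pM // mulr_ge0.
suff [] : K (\prod_i h i ^+ al i) (\prod_i k i ^+ al i) (\sum_i al i)%N by [].
apply: (big_ind3 K) => // i _.
elim: (al i) => [|d IH] //; rewrite !exprS -add1n; apply: KM IH.
by split; rewrite ?expr1 // mul1r ler_wpM2l.
Qed.

(** For degree d the Lipschitz bound is d e^(d-1) s. Keeping [e] below half of [rho] gains a factor
    2^(d-3), which absorbs d because d <= 3 * 2^(d-3) for d >= 3; this is the origin of the constant
    3. *)
Lemma monomial_lipschitz_tail (rho e s : R) h k (al : I -> nat) :
  0 < e -> e <= rho / 2 -> 0 <= s ->
  (forall i, `|h i| <= e) -> (forall i, `|k i| <= e) ->
  (forall i, `|h i - k i| <= s) -> (2 < \sum_i al i)%N ->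
  `|\prod_i h i ^+ al i - \prod_i k i ^+ al i|
    <= 3 / rho ^+ 3 * e ^+ 2 * s * rho ^+ (\sum_i al i).
Proof.
move=> e0 er s0 he ke hk; move: (monomial_lipschitz al (ltW e0) s0 he ke hk).
set X := `|_ - _|; set d := (\sum_i al i)%N => hX d3.
have r0 : 0 < rho by lra.
rewrite -(ler_pM2l e0); apply: le_trans hX _.
have -> : e * (3 / rho ^+ 3 * e ^+ 2 * s * rho ^+ d) =
          e ^+ 3 * (3 * rho ^+ (d - 3)) * s.
  by rewrite -{1}(subnK d3) exprD; field; rewrite gt_eqF.
rewrite ler_wpM2r //.
have -> : e ^+ d = e ^+ 3 * e ^+ (d - 3) by rewrite -exprD subnKC.
rewrite mulrCA ler_wpM2l ?(exprn_ge0 _ (ltW e0)) //.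
apply: le_trans (_ : d%:R * (rho / 2) ^+ (d - 3) <= _).
  by rewrite ler_wpM2l // lerXn2r // ?nnegrE; lra.
rewrite exprMn exprVn mulrA ler_pdivrMr ?exprn_gt0 //.
rewrite mulrAC ler_wpM2r ?(exprn_ge0 _ (ltW r0)) //.
have : (d <= 3 * 2 ^ (d - 3))%N.
  rewrite -{1}(subnK d3); elim: (d - 3)%N => // j; rewrite expnS; lia.
by rewrite -(ler_nat R) natrM natrX.
Qed.

(** The exponents of a partial sum range over a finite type depending on [N]. The terms of degree at
    most 2 are matched with those of the second partial sum through the embedding [up] and the
    truncation [dn]. *)
Lemma ps_partial_split c y x N : (2 <= N)%N ->
  ps_partial c y x N = ps_partial c y x 2 +
  \sum_(al : {ffun I -> 'I_N.+1} |
      (2 < \sum_i nat_of_ord (al i) <= N)%N)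
    c (fun i => nat_of_ord (al i)) * \prod_i (x i - y i) ^+ (al i).
Proof.
move=> N2; rewrite {1}/ps_partial.
rewrite (bigID (fun al : {ffun I -> 'I_N.+1} => (\sum_i nat_of_ord (al i) <= 2)%N)) /=.
congr (_ + _); last first.
  by apply: eq_bigl => al; rewrite andbC -ltnNge.
pose up (b : {ffun I -> 'I_3}) : {ffun I -> 'I_N.+1} := [ffun i => inord (b i)].
pose dn (b : {ffun I -> 'I_N.+1}) : {ffun I -> 'I_3} := [ffun i => inord (b i)].
have upE b i : up b i = b i :> nat.
  by rewrite ffunE inordK // (leq_trans (ltn_ord _)).
have dnE (b : {ffun I -> 'I_N.+1}) i : (\sum_i nat_of_ord (b i) <= 2)%N -> dn b i = b i :> nat.
  move=> hb; rewrite ffunE inordK // ltnS; apply: leq_trans hb.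
  by rewrite (bigD1 i) //= leq_addr.
rewrite (reindex_onto up dn) /=; last first.
  move=> b /andP[_ hb]; apply/ffunP => i; apply: val_inj => /=.
  by rewrite upE dnE.
rewrite /ps_partial; apply: eq_big => [b|b _].
  have -> : (\sum_i nat_of_ord (up b i) = \sum_i nat_of_ord (b i))%N.
    by apply: eq_bigr => i _; rewrite upE.
  case: (leqP (\sum_i nat_of_ord (b i)) 2) => [hb|]; last by rewrite andbF.
  rewrite (leq_trans hb N2) /=; apply/eqP/ffunP => i; apply: val_inj => /=.
  rewrite dnE ?upE //.
  by under eq_bigr do rewrite upE.
congr (c _ * _); first by apply: funext => i; rewrite upE.
by apply: eq_bigr => i _; rewrite upE.
Qed.

Lemma is_quad_ps_partial2 c y :
  is_quad (fun h => ps_partial c y (fun i => y i + h i) 2).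
Proof.
rewrite /ps_partial; apply: is_quad_sum => al hal.
apply: is_quadZ; apply: is_quad_ext (@is_quad_monomial R I (fun i => al i) hal) => h /=.
by apply: eq_bigr => i _; rewrite addrC addKr.
Qed.

(** The estimate concerns a difference of two values, with a Lipschitz factor [s], so that it serves
    twice. At [x' = y] it gives a cubic remainder for [f]; for [x] and [x'] at distance t -> 0 it
    gives, after division by t, a quadratic remainder for the partial derivatives, with no termwise
    differentiation of the series. *)
Lemma analytic_at_taylor2 (V : (I -> R) -> Prop) (f : (I -> R) -> R) y :
  analytic_at V f y ->
  exists (a : R) (l : I -> R) (q : I -> I -> R) (C rho : R), [/\ symmetric_array q, 0 <= C, 0 < rho &
    forall x x' (e s : R), 0 < e -> e <= rho -> 0 <= s ->
      (forall i, `|x i - y i| <= e) -> (forall i, `|x' i - y i| <= e) ->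
      (forall i, `|x i - x' i| <= s) ->
      `|f x - f x' - (quad a l q (fun i => x i - y i) -
                      quad a l q (fun i => x' i - y i))| <= C * e ^+ 2 * s].
Proof.
move=> [r [r0 [c hc]]].
have [a [l [q [qs hq]]]] := is_quad_ps_partial2 c y.
(* At this point all the factors |x_i - y_i| equal r / 2, so the bound [M] found there controls the
   sum of |c_al| (r / 2)^|al|. *)
have hr : dmax (fun i => y i + r / 2) y < r.
  by apply: dmax_lt => // i; rewrite addrAC subrr add0r ger0_norm; lra.
have [_ [[M hM] _]] := hc _ hr.
(* [monomial_lipschitz_tail] is applied with rho = r / 2; its condition e <= rho / 2 is the radius r
   / 4. *)
exists a, l, q, (`|M| * (3 / (r / 2) ^+ 3)), (r / 4).
split=> //; [by rewrite mulr_ge0 // divr_ge0 // exprn_ge0 // ltW // divr_gt0|by rewrite divr_gt0|].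
move=> x x' e s e0 er s0 hx hx' hxx'.
have near_cvg w : (forall i, `|w i - y i| <= e) -> (fun N => ps_partial c y w N) @ \oo --> f w.
  move=> hw; have hwr : dmax w y < r.
    by apply: dmax_lt => // i; apply: le_lt_trans (hw i) _; lra.
  by have [_ []] := hc _ hwr.
have E w : quad a l q (fun i => w i - y i) = ps_partial c y w 2.
  rewrite -hq; congr (ps_partial c y _ 2); apply: funext => i; ring.
have lim : (fun N => `|ps_partial c y x N - ps_partial c y x' N -
     (ps_partial c y x 2 - ps_partial c y x' 2)|) @ \oo -->
   `|f x - f x' - (ps_partial c y x 2 - ps_partial c y x' 2)|.
  apply: cvg_norm; apply: cvgB; last exact: cvg_cst.
  by apply: cvgB; apply: near_cvg.
rewrite !E; apply: (ler_cvg_to lim (cvg_cst _)).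
exists 2%N => // N /= N2; rewrite !(ps_partial_split c y _ N2).
set D := \sum_(al | _) _; set D' := \sum_(al | _) _.
have -> : ps_partial c y x 2 + D - (ps_partial c y x' 2 + D') -
  (ps_partial c y x 2 - ps_partial c y x' 2) = D - D' by ring.
rewrite /D /D' -sumrB; apply: le_trans (ler_norm_sum _ _ _) _.
have -> : `|M| * (3 / (r / 2) ^+ 3) * e ^+ 2 * s =
  `|M| * (3 / (r / 2) ^+ 3 * e ^+ 2 * s) by ring.
set B := 3 / _ * _ * _.
have B0 : 0 <= B by rewrite !mulr_ge0 ?invr_ge0 ?exprn_ge0 // ltW // divr_gt0.
apply: le_trans (_ : M * B <= _); last by rewrite ler_wpM2r // ler_norm.
apply: le_trans (_ : ps_abs_partial c y (fun i => y i + r / 2) N * B <= _); last first.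
  by rewrite ler_wpM2r.
rewrite /ps_abs_partial mulr_suml.
rewrite [X in _ <= X](bigID (fun al : {ffun I -> 'I_N.+1} =>
   (\sum_i nat_of_ord (al i) <= 2)%N)) /= ler_wpDl //.
  apply: sumr_ge0 => al _; apply: mulr_ge0 B0; apply: mulr_ge0 => //; apply: prodr_ge0 => i _.
  by rewrite exprn_ge0.
rewrite [leRHS](eq_bigl (fun al : {ffun I -> 'I_N.+1} => (2 < \sum_i nat_of_ord (al i) <= N)%N)); last first.
  by move=> al; rewrite andbC -ltnNge.
apply: ler_sum => al /andP[al2 _]; rewrite -mulrBr normrM -mulrA ler_wpM2l //.
have -> : \prod_i `|y i + r / 2 - y i| ^+ al i = (r / 2) ^+ (\sum_i nat_of_ord (al i)).
  rewrite -prodrXr; apply: eq_bigr => i _; rewrite addrAC subrr add0r ger0_norm //.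
  by rewrite ltW // divr_gt0.
rewrite mulrC; apply: monomial_lipschitz_tail => // [|i]; first by lra.
by apply: le_trans (hxx' i); rewrite opprB addrA subrK.
Qed.

End PowerSeries.

(** * Taylor expansions of analytic functions and of their first derivatives *)

Section TaylorExpansions.
Variables (R : realType) (I : finType).
Implicit Types (x y h v l : I -> R) (q : I -> I -> R) (f : (I -> R) -> R).

Lemma quad0 (a : R) l q : quad a l q (fun=> 0) = a.
Proof.
rewrite /quad big1 => [|i _]; last by rewrite mulr0.
rewrite big1 => [|i _]; first by rewrite mulr0 !addr0.
by rewrite big1 // => j _; rewrite mulr0.
Qed.

Lemma quad_shift (a : R) l q h v (t : R) : symmetric_array q ->
  quad a l q (fun i => h i + t * v i) =
  quad a l q h + t * \sum_i (l i + \sum_j q i j * h j) * v i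
  + t ^+ 2 * (2^-1 * \sum_i \sum_j q i j * v i * v j).
Proof.
move=> qs; rewrite /quad.
have -> : \sum_i l i * (h i + t * v i) = \sum_i l i * h i + t * \sum_i l i * v i.
  by rewrite mulr_sumr -big_split; apply: eq_bigr => i _ /=; ring.
have -> : \sum_i (l i + \sum_j q i j * h j) * v i =
   \sum_i l i * v i + \sum_i \sum_j q i j * h j * v i.
  rewrite -big_split; apply: eq_bigr => i _ /=; rewrite mulrDl; congr (_ + _).
  by rewrite mulr_suml.
have -> : \sum_i \sum_j q i j * (h i + t * v i) * (h j + t * v j) =
  \sum_i \sum_j q i j * h i * h j + t * \sum_i \sum_j q i j * h i * v j +
  t * \sum_i \sum_j q i j * h j * v i + t ^+ 2 * \sum_i \sum_j q i j * v i * v j.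
  rewrite !mulr_sumr -!big_split; apply: eq_bigr => i _ /=.
  by rewrite !mulr_sumr -!big_split; apply: eq_bigr => j _ /=; ring.
have -> : \sum_i \sum_j q i j * h i * v j = \sum_i \sum_j q i j * h j * v i.
  by rewrite exchange_big; apply: eq_bigr => i _; apply: eq_bigr => j _; rewrite qs.
by field.
Qed.

Lemma quad_form_le q h (e : R) : (forall i, `|h i| <= e) ->
  `|\sum_i \sum_j q i j * h i * h j| <= (\sum_i \sum_j `|q i j|) * e ^+ 2.
Proof.
move=> he; rewrite mulr_suml; apply: le_trans (ler_norm_sum _ _ _) _.
apply: ler_sum => i _; rewrite mulr_suml; apply: le_trans (ler_norm_sum _ _ _) _.
apply: ler_sum => j _; rewrite !normrM -mulrA ler_wpM2l //.
by rewrite expr2 ler_pM.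
Qed.

Lemma dmax_shift y v (t : R) :
  dmax (fun i => y i + t * v i) y <= `|t| * dmax v (fun=> 0).
Proof.
apply: dmax_le => [|i]; first by rewrite mulr_ge0 ?dmax_ge0.
rewrite addrAC subrr add0r normrM ler_wpM2l //.
by have := le_dmax v (fun=> 0) i; rewrite subr0.
Qed.

Definition taylor1_at f y l := exists C rho : R, 0 < rho /\ forall x, dmax x y <= rho ->
  `|f x - f y - \sum_i l i * (x i - y i)| <= C * dmax x y ^+ 2.

Lemma dmax_eq0 x y : dmax x y = 0 -> x = y.
Proof.
move=> d0; apply: funext => i; apply/eqP; rewrite -subr_eq0 -normr_eq0.
by rewrite eq_le normr_ge0 andbT -d0 le_dmax.
Qed.

Lemma quad_error_taylor1 f y (a : R) l q (C rho : R) : 0 < rho -> 0 <= C ->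
  (forall x, dmax x y <= rho ->
    `|f x - f y - (quad a l q (fun i => x i - y i) - a)| <= C * dmax x y ^+ 3) ->
  taylor1_at f y l.
Proof.
move=> r0 C0 hf; exists (C * rho + 2^-1 * (\sum_i \sum_j `|q i j|)), rho; split=> // x hx.
have := hf x hx; rewrite /quad => h1.
have h2 := quad_form_le q (le_dmax x y).
set S := \sum_i l i * _ in h1 *; set T := \sum_i \sum_j _ in h1 h2.
have -> : f x - f y - S = (f x - f y - (a + S + 2^-1 * T - a)) + 2^-1 * T by ring.
apply: le_trans (ler_normD _ _) _; rewrite mulrDl lerD //.
  apply: le_trans h1 _; rewrite exprS mulrA ler_wpM2r ?exprn_ge0 ?dmax_ge0 //.
  by rewrite ler_wpM2l.
by rewrite normrM -mulrA ger0_norm // ler_wpM2l.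
Qed.

Lemma taylor1_line f y l v : taylor1_at f y l ->
  exists C r : R, 0 < r /\ forall t, `|t| < r ->
    `|f (fun i => y i + t * v i) - f y - t * \sum_i l i * v i| <= C * t ^+ 2.
Proof.
move=> [C [rho [r0 hf]]].
set B := dmax v (fun=> 0); have B0 : 0 <= B := dmax_ge0 _ _.
have B1 : 0 < B + 1 by rewrite ltr_wpDl.
exists (`|C| * B ^+ 2), (rho / (B + 1)); split; first by rewrite divr_gt0.
move=> t; rewrite ltr_pdivlMr // => ht.
have hd := dmax_shift y v t; rewrite -/B in hd.
have hr : dmax (fun i => y i + t * v i) y <= rho.
  apply: le_trans hd _; apply: le_trans (ltW ht); rewrite ler_wpM2l //; lra.
have := hf _ hr.
have -> : \sum_i l i * (y i + t * v i - y i) = t * \sum_i l i * v i.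
  by rewrite mulr_sumr; apply: eq_bigr => i _; ring.
move=> h; apply: le_trans h _.
apply: le_trans (_ : `|C| * dmax (fun i => y i + t * v i) y ^+ 2 <= _).
  by rewrite ler_wpM2r ?exprn_ge0 ?dmax_ge0 // ler_norm.
rewrite -mulrA ler_wpM2l // -[t ^+ 2]real_normK ?num_real // -exprMn.
by rewrite lerXn2r // ?nnegrE ?dmax_ge0 ?mulr_ge0 // mulrC.
Qed.

Lemma taylor1_dirderiv f y l v : taylor1_at f y l -> dirderiv f y v = \sum_i l i * v i.
Proof.
move=> /(taylor1_line v) [C [r [r0 hf]]].
apply: (derive1_of_quadratic_error r0 (C := C)) => t ht.
have -> : (fun i => y i + 0 * v i) = y by apply: funext => i; rewrite mul0r addr0.
exact: hf.
Qed.

Lemma sum_delta (g : I -> R) i0 : \sum_i g i * (if i == i0 then 1 else 0) = g i0.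
Proof.
rewrite (bigD1 i0) //= eqxx mulr1 big1 ?addr0 // => i /negbTE ->.
by rewrite mulr0.
Qed.

Lemma taylor1_pderiv f y l i : taylor1_at f y l -> pderiv f i y = l i.
Proof. by move=> hf; rewrite /pderiv (taylor1_dirderiv _ hf) sum_delta. Qed.

Lemma analytic_at_taylor1 V f y : analytic_at V f y ->
  taylor1_at f y (fun i => pderiv f i y).
Proof.
move=> /analytic_at_taylor2 [a [l [q [C [rho [qs C0 r0 hf]]]]]].
have T : taylor1_at f y l.
  apply: (@quad_error_taylor1 _ _ a l q C rho) => // x hx.
  have [d0|d0] := eqVneq (dmax x y) 0.
    have -> := dmax_eq0 d0.
    have -> : (fun i => y i - y i) = (fun=> 0) by apply: funext => i; rewrite subrr.
    by rewrite quad0 !subrr normr0 dmaxxx expr0n mulr0.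
  have dp : 0 < dmax x y by rewrite lt_neqAle eq_sym d0 dmax_ge0.
  have := hf x y _ _ dp hx (ltW dp) (le_dmax x y) _ (le_dmax x y).
  have -> : (fun i => y i - y i) = (fun=> 0) by apply: funext => i; rewrite subrr.
  rewrite quad0 => h; apply: le_trans (h _) _; last by rewrite -mulrA -exprSr.
  by move=> i; rewrite subrr normr0 ltW.
have -> // : (fun i => pderiv f i y) = l.
by apply: funext => i; rewrite (taylor1_pderiv i T).
Qed.

(** For the derivative at [x], the increment of [f] from [x] to x + t d/dx^i is compared with its
    first-order expansion at [x] and with the increment of the quadratic polynomial centred at
    [y]. *)
Lemma real_analytic_taylor2 V f y : real_analytic_on V f -> V y ->
  exists q (C rho : R), [/\ symmetric_array q, 0 <= C, 0 < rho &
    forall x, dmax x y <= rho -> [/\ V x,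
      `|f x - quad (f y) (fun i => pderiv f i y) q (fun i => x i - y i)|
         <= C * dmax x y ^+ 3 &
      forall i, `|pderiv f i x - (pderiv f i y + \sum_j q i j * (x j - y j))|
         <= C * dmax x y ^+ 2]].
Proof.
move=> [Vo Va] Vy; have [a [l [q [C [rho [qs C0 r0 hf]]]]]] := analytic_at_taylor2 (Va _ Vy).
have [r1 [r10 hr1]] := Vo _ Vy.
have diag : (fun i => y i - y i) = (fun=> 0) by apply: funext => i; rewrite subrr.
have dpos x : dmax x y != 0 -> 0 < dmax x y.
  by move=> d0; rewrite lt_neqAle eq_sym d0 dmax_ge0.
have h3 x : dmax x y <= rho ->
    `|f x - f y - (quad a l q (fun i => x i - y i) - a)| <= C * dmax x y ^+ 3.
  move=> hx; have [d0|d0] := eqVneq (dmax x y) 0.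
    by rewrite (dmax_eq0 d0) diag quad0 !subrr normr0 dmaxxx expr0n mulr0.
  have dp := dpos _ d0.
  have := hf x y _ _ dp hx (ltW dp) (le_dmax x y) _ (le_dmax x y).
  rewrite diag quad0 => h; apply: le_trans (h _) _; last by rewrite -mulrA -exprSr.
  by move=> i; rewrite subrr normr0 ltW.
have T := quad_error_taylor1 r0 C0 h3.
have El : (fun i => pderiv f i y) = l.
  by apply: funext => i; rewrite (taylor1_pderiv i T).
have Eli i : pderiv f i y = l i by rewrite -El.
rewrite El.
(* For 0 < t < d = [dmax x y] both ends of the increment lie within 2d of [y]. The Lipschitz
   estimate then has the coefficient C (2d)^2 = 4 C d^2, and it requires 2d <= rho. *)
exists q, (4 * C), (Num.min (rho / 2) (r1 / 2)).
split=> //; [by rewrite mulr_ge0|by rewrite lt_min !divr_gt0|].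
move=> x; rewrite le_min => /andP[hx hx1].
have Vx : V x by apply: hr1; apply: le_lt_trans hx1 _; lra.
split=> //.
  have := h3 x _; set d := dmax x y in hx *.
  have -> : f x - f y - (quad a l q (fun i => x i - y i) - a) =
            f x - quad (f y) l q (fun i => x i - y i) by rewrite /quad; ring.
  move=> h; apply: le_trans (h _) _; first by lra.
  have : 0 <= C * d ^+ 3 by rewrite mulr_ge0 ?exprn_ge0 ?dmax_ge0.
  by lra.
move=> i; rewrite Eli.
have [d0|d0] := eqVneq (dmax x y) 0.
  rewrite (dmax_eq0 d0) Eli dmaxxx expr0n mulr0 big1 ?addr0 ?subrr ?normr0 // => j _.
  by rewrite subrr mulr0.
have dp := dpos _ d0; set d := dmax x y in hx hx1 d0 dp *.
have [Cx [rx [rx0 hTx]]] := analytic_at_taylor1 (Va _ Vx).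
set L := pderiv f i x; set Q' := l i + _.
pose D (j : I) : R := if j == i then 1 else 0.
(* The remainder at [x] and the quadratic term in the direction [D] are both O(t^2), so they
   disappear on dividing by t and letting t tend to 0. *)
apply: (@le_of_linear_error R (Num.min d rx) (`|Cx| + 2^-1 * `|q i i|)).
  by rewrite lt_min dp.
move=> t t0; rewrite lt_min => /andP[td tr].
have dD : dmax (fun j => x j + t * D j) x <= t.
  apply: dmax_le => [|j]; first exact: ltW.
  rewrite addrAC subrr add0r normrM (gtr0_norm t0) /D; case: eqP => _.
    by rewrite normr1 mulr1.
  by rewrite normr0 mulr0 ltW.
have := hTx (fun j => x j + t * D j) (le_trans dD (ltW tr)).
have -> : \sum_j pderiv f j x * (x j + t * D j - x j) = t * L.
  rewrite /L -(sum_delta (fun j => pderiv f j x) i) mulr_sumr; apply: eq_bigr => j _.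
  by rewrite /D; ring.
move=> e1.
have d2 : 0 < 2 * d by rewrite mulr_gt0.
have e2 : `|f (fun j => x j + t * D j) - f x -
   (quad a l q (fun j => x j - y j + t * D j) - quad a l q (fun j => x j - y j))|
   <= C * (2 * d) ^+ 2 * t.
  have -> : (fun j => x j - y j + t * D j) = (fun j => x j + t * D j - y j).
    by apply: funext => j; ring.
  apply: hf => //; [lra|lra| | |].
  - move=> j; apply: le_trans (le_dmax (fun j => x j + t * D j) y j) _.
    apply: le_trans (dmax_triangle _ x _) _; rewrite -/d; lra.
  - by move=> j; apply: le_trans (le_dmax x y j) _; rewrite -/d; lra.
  - by move=> j; apply: le_trans (le_dmax (fun j => x j + t * D j) x j) _.
move: e2; rewrite (quad_shift a l _ D t qs) sum_delta -/Q'.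
have -> : \sum_i0 \sum_j q i0 j * D i0 * D j = q i i.
  under eq_bigr do rewrite sum_delta.
  by rewrite sum_delta.
set G := quad _ _ _ _; set Fd := f _ - f x => e2.
have e3 : `|Fd - t * L| <= `|Cx| * t ^+ 2.
  apply: le_trans e1 _; apply: le_trans (_ : `|Cx| * dmax (fun j => x j + t * D j) x ^+ 2 <= _).
    by rewrite ler_wpM2r ?exprn_ge0 ?dmax_ge0 // ler_norm.
  by rewrite ler_wpM2l // lerXn2r // nnegrE ?dmax_ge0 // ltW.
rewrite -{1}(gtr0_norm t0) -normrM.
have -> : t * (L - Q') = (Fd - (G + t * Q' + t ^+ 2 * (2^-1 * q i i) - G))
   - (Fd - t * L) + t ^+ 2 * (2^-1 * q i i) by ring.
apply: le_trans (ler_normD _ _) _; apply: le_trans (lerD (ler_normB _ _) (lexx _)) _.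
rewrite [X in _ + X]normrM (_ : `|t ^+ 2| = t ^+ 2); last by rewrite ger0_norm // exprn_ge0 // ltW.
rewrite [`|2^-1 * _|]normrM [`|2^-1|]ger0_norm //.
move: e2 e3; set A1 := `|_ - (_ - G)|; set A2 := `|_ - t * L|; move=> e2 e3.
have -> : t * (4 * C * d ^+ 2) + (`|Cx| + 2^-1 * `|q i i|) * t ^+ 2 =
   C * (2 * d) ^+ 2 * t + `|Cx| * t ^+ 2 + t ^+ 2 * (2^-1 * `|q i i|) by ring.
by rewrite !lerD.
Qed.

Lemma pderiv_locally_bounded V f y : real_analytic_on V f -> V y ->
  exists C rho : R, [/\ 0 <= C, 0 < rho &
    forall x i, dmax x y <= rho -> `|pderiv f i x| <= C].
Proof.
move=> hf Vy; have [q [C [rho [qs C0 r0 h]]]] := real_analytic_taylor2 hf Vy.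
set B := \sum_i (`|pderiv f i y| + \sum_j `|q i j| * rho).
have T0 i : 0 <= `|pderiv f i y| + \sum_j `|q i j| * rho.
  by rewrite addr_ge0 // sumr_ge0 // => j _; rewrite mulr_ge0 // ltW.
exists (C * rho ^+ 2 + B), rho; split=> //.
  by rewrite addr_ge0 ?mulr_ge0 ?exprn_ge0 ?(ltW r0) // sumr_ge0.
move=> x i hx; have [_ _ /(_ i) hi] := h _ hx.
rewrite -[pderiv f i x](subrK (pderiv f i y + \sum_j q i j * (x j - y j))).
apply: le_trans (ler_normD _ _) _; apply: lerD.
  apply: le_trans hi _; rewrite ler_wpM2l // lerXn2r // nnegrE ?dmax_ge0 ?(ltW r0) //.
apply: le_trans (_ : `|pderiv f i y| + \sum_j `|q i j| * rho <= _); last first.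
  by rewrite /B [leRHS](bigD1 i) //= lerDl sumr_ge0.
apply: le_trans (ler_normD _ _) _; rewrite lerD2l.
apply: le_trans (ler_norm_sum _ _ _) _; apply: ler_sum => j _.
by rewrite normrM ler_wpM2l // (le_trans (le_dmax x y j)).
Qed.

End TaylorExpansions.

(** * Analyticity of the quadratic polynomials used as initial data *)

Section AnalyticQuadratics.
Variables (R : realType) (I : finType).
Implicit Types (x y h v l : I -> R) (q : I -> I -> R) (f : (I -> R) -> R).

(** Convergence at every point, rather than on a ball, means that no radii have to be intersected
    when functions are added. *)
Definition entire_at f y := exists c : (I -> nat) -> R, forall x,
  (exists M : R, forall N, ps_abs_partial c y x N <= M) /\
  (fun N => ps_partial c y x N) @ \oo --> f x.

Lemma entire_at_analytic f y : entire_at f y -> analytic_at (fun=> True) f y.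
Proof. by move=> [c hc]; exists 1; split=> //; exists c => x _; split. Qed.

Lemma entire_atD f g y : entire_at f y -> entire_at g y ->
  entire_at (fun x => f x + g x) y.
Proof.
move=> [c hc] [c' hc']; exists (fun al => c al + c' al) => x.
have [[M hM] cv] := hc x; have [[M' hM'] cv'] := hc' x; split.
  exists (M + M') => N; apply: le_trans (lerD (hM N) (hM' N)).
  rewrite /ps_abs_partial -big_split; apply: ler_sum => al _ /=.
  rewrite -mulrDl ler_wpM2r ?ler_normD //.
  by apply: prodr_ge0 => i _; rewrite exprn_ge0.
rewrite (_ : (fun N => _) = (fun N => ps_partial c y x N + ps_partial c' y x N)).
  exact: cvgD.
apply: funext => N; rewrite /ps_partial -big_split; apply: eq_bigr => al _ /=.
by rewrite mulrDl.
Qed.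

Lemma entire_atZ (a : R) f y : entire_at f y -> entire_at (fun x => a * f x) y.
Proof.
move=> [c hc]; exists (fun al => a * c al) => x.
have [[M hM] cv] := hc x; split.
  exists (`|a| * M) => N; apply: le_trans (ler_wpM2l (normr_ge0 a) (hM N)).
  rewrite /ps_abs_partial mulr_sumr; apply: ler_sum => al _ /=.
  by rewrite normrM mulrA.
rewrite (_ : (fun N => _) = (fun N => a * ps_partial c y x N)).
  by apply: cvgM => //; exact: cvg_cst.
by apply: funext => N; rewrite /ps_partial mulr_sumr; apply: eq_bigr => al _ /=; rewrite mulrA.
Qed.

(** The series has a single nonzero coefficient, so its partial sums are constant from the degree of
    the monomial on. *)
Lemma entire_at_monomial (b : I -> nat) y :
  entire_at (fun x => \prod_i (x i - y i) ^+ b i) y.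
Proof.
pose c (al : I -> nat) : R := [forall i, al i == b i]%:R.
have E (g : I -> nat -> R) N :
    \sum_(al : {ffun I -> 'I_N.+1} | (\sum_i nat_of_ord (al i) <= N)%N)
      c (fun i => nat_of_ord (al i)) * \prod_i g i (al i) =
    if (\sum_i b i <= N)%N then \prod_i g i (b i) else 0.
  case: leqP => hb.
    pose al0 : {ffun I -> 'I_N.+1} := [ffun i => inord (b i)].
    have al0E i : al0 i = b i :> nat.
      by rewrite ffunE inordK // ltnS (leq_trans _ hb) // (bigD1 i) //= leq_addr.
    rewrite (bigD1 al0) /=; last by under eq_bigr do rewrite al0E.
    rewrite [X in _ + X]big1 ?addr0.
      have -> : c (fun i => al0 i) = 1.
        by rewrite /c (_ : [forall i, _] = true) //; apply/forallP => i; rewrite al0E.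
      rewrite mul1r.
      by under eq_bigr do rewrite al0E.
    move=> al /andP[_ ne]; rewrite /c; case: forallP => [h|]; last by rewrite mul0r.
    case/eqP: ne; apply/ffunP => i; apply: val_inj => /=.
    by rewrite al0E; apply/eqP.
  rewrite big1 // => al hal; rewrite /c; case: forallP => [h|]; last by rewrite mul0r.
  have : (\sum_i nat_of_ord (al i) = \sum_i b i)%N by apply: eq_bigr => i _; apply/eqP.
  by move=> e; rewrite e leqNgt hb in hal.
exists c => x; split.
  exists (\prod_i `|x i - y i| ^+ b i) => N.
  rewrite /ps_abs_partial (eq_bigr (fun al : {ffun I -> 'I_N.+1} =>
    c (fun i => nat_of_ord (al i)) * \prod_i `|x i - y i| ^+ (al i))); last first.
    by move=> al _; rewrite ger0_norm.
  rewrite (E (fun i d => `|x i - y i| ^+ d)); case: ifP => // _.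
  by apply: prodr_ge0 => i _; rewrite exprn_ge0.
apply: cvg_near_cst; exists (\sum_i b i)%N => // N /= hN.
by rewrite /ps_partial (E (fun i d => (x i - y i) ^+ d)) hN.
Qed.

Lemma entire_at_ext f g y : f =1 g -> entire_at g y -> entire_at f y.
Proof. by move=> e; rewrite (_ : f = g) //; apply: funext. Qed.

Lemma entire_at_sum (J : finType) (F : J -> (I -> R) -> R) y :
  (forall j, entire_at (F j) y) -> entire_at (fun x => \sum_j F j x) y.
Proof.
move=> hF.
have H (s : seq J) : entire_at (fun x => \sum_(j <- s) F j x) y.
  elim: s => [|j s IH].
    apply: entire_at_ext (entire_atZ 0 (entire_at_monomial (fun=> 0%N) y)) => x.
    by rewrite big_nil mul0r.
  by apply: entire_at_ext (entire_atD (hF j) IH) => x; rewrite big_cons.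
exact: H.
Qed.

Lemma entire_at_quad (a : R) l q y : entire_at (fun x => quad a l q (fun i => x i - y i)) y.
Proof.
have coord i : entire_at (fun x => x i - y i) y.
  apply: entire_at_ext (entire_at_monomial (fun j => (j == i) : nat) y) => x.
  rewrite (bigD1 i) //= eqxx expr1 big1 ?mulr1 // => j /negbTE ->.
  by rewrite expr0.
have coord2 i j : entire_at (fun x => (x i - y i) * (x j - y j)) y.
  apply: entire_at_ext (entire_at_monomial (fun s => (s == i) + (s == j))%N y) => x.
  have sel i0 : \prod_s (x s - y s) ^+ (s == i0) = x i0 - y i0.
    rewrite (bigD1 i0) //= eqxx expr1 big1 ?mulr1 // => s /negbTE ->.
    by rewrite expr0.
  by under eq_bigr do rewrite exprD; rewrite big_split /= !sel.
apply: entire_atD; last first.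
  apply: entire_atZ; apply: entire_at_sum => i; apply: entire_at_sum => j.
  by apply: entire_at_ext (entire_atZ (q i j) (coord2 i j)) => x; rewrite mulrA.
apply: entire_atD; last by apply: entire_at_sum => i; apply: entire_atZ.
apply: entire_at_ext (entire_atZ a (entire_at_monomial (fun=> 0%N) y)) => x.
by rewrite big1 ?mulr1.
Qed.

(** By [quad_shift], a quadratic polynomial centred at [y] is again one when recentred at any [w],
    so a single power series at the centre is enough. *)
Lemma real_analytic_quad (a : R) l q y : symmetric_array q ->
  real_analytic_on (fun=> True) (fun x => quad a l q (fun i => x i - y i)).
Proof.
move=> qs; split=> [w _|w _]; first by exists 1.
apply: entire_at_analytic.
set v := fun i => w i - y i.
apply: entire_at_ext (entire_at_quad (quad a l q v)
  (fun i => l i + \sum_j q i j * v j) q w) => x.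
have -> : (fun i => x i - y i) = (fun i => v i + 1 * (x i - w i)).
  by apply: funext => i; rewrite /v; ring.
by rewrite quad_shift // expr1n !mul1r.
Qed.

Lemma pderiv_quad (a : R) l q y i :
  pderiv (fun x => quad a l q (fun i => x i - y i)) i y = l i.
Proof.
apply: taylor1_pderiv.
apply: (@quad_error_taylor1 R I _ _ a l q 0 1) => // x _.
have -> : (fun i => y i - y i) = (fun=> 0) by apply: funext => j; rewrite subrr.
by rewrite quad0 subrr normr0 mul0r.
Qed.

End AnalyticQuadratics.

(** * Errors of second order along curves *)

Section SecondOrderError.
Variable R : realType.

Definition O2 (g : R -> R) := exists C r : R,
  [/\ 0 <= C, 0 < r & forall t, 0 < t -> t < r -> `|g t| <= C * t ^+ 2].

Lemma finite_radius (J : finType) (P : J -> R -> Prop) :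
  (forall j, exists r : R, 0 < r /\ forall t, 0 < t -> t < r -> P j t) ->
  exists r : R, 0 < r /\ forall t, 0 < t -> t < r -> forall j, P j t.
Proof.
move=> /choice [r hr]; exists (\big[Num.min/1]_j r j); split.
  by elim/big_ind: _ => // [a b a0 b0|j _]; [rewrite lt_min a0|case: (hr j)].
move=> t t0 tr j; apply: (proj2 (hr j)) => //; apply: lt_le_trans tr _.
by rewrite (bigD1 j) //= ge_min lexx.
Qed.

Lemma O2_uniform (J : finType) (g : J -> R -> R) : (forall j, O2 (g j)) ->
  exists C r : R, [/\ 0 <= C, 0 < r &
    forall t, 0 < t -> t < r -> forall j, `|g j t| <= C * t ^+ 2].
Proof.
move=> /choice [C hC].
have C0 j : 0 <= C j by case: (hC j) => r [].
have [|r [r0 hr]] := @finite_radius J (fun j t => `|g j t| <= C j * t ^+ 2).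
  by move=> j; have [r [_ r0 h]] := hC j; exists r.
exists (\sum_j C j), r; split=> //; first exact: sumr_ge0.
move=> t t0 tr j; apply: le_trans (hr t t0 tr j) _; rewrite ler_wpM2r ?exprn_ge0 ?(ltW t0) //.
by rewrite (bigD1 j) //= ler_wpDr // sumr_ge0.
Qed.

Lemma O2D (f g : R -> R) : O2 f -> O2 g -> O2 (fun t => f t + g t).
Proof.
move=> [C [r [C0 r0 h]]] [C' [r' [C0' r0' h']]].
exists (C + C'), (Num.min r r'); split; rewrite ?addr_ge0 ?lt_min ?r0 // => t t0.
rewrite lt_min => /andP[tr tr']; apply: le_trans (ler_normD _ _) _.
by rewrite mulrDl lerD ?h ?h'.
Qed.

Lemma O2N (f : R -> R) : O2 f -> O2 (fun t => - f t).
Proof. by move=> [C [r [C0 r0 h]]]; exists C, r; split=> // t t0 tr; rewrite normrN h. Qed.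

Lemma O2_linear_eq0 (a : R) : O2 (fun t => t * a) -> a = 0.
Proof. by move=> [C [r [_ r0 h]]]; apply: eq0_of_linear_error r0 h. Qed.

Lemma O2_ext (f g : R -> R) : f =1 g -> O2 g -> O2 f.
Proof. by move=> /funext ->. Qed.

(** A chain rule for remainders: the curve only needs a first-order expansion at 0, and it is not
    differentiated anywhere. *)
Lemma taylor1_curve (J : finType) (f : (J -> R) -> R) (y l w : J -> R) (c : R -> J -> R) :
  taylor1_at f y l -> (forall j, O2 (fun t => c t j - y j - t * w j)) ->
  O2 (fun t => f (c t) - f y - t * \sum_j l j * w j).
Proof.
move=> [C [rho [rho0 hf]]] hc.
have [K [r [K0 r0 hK]]] := O2_uniform hc.
set B := dmax w (fun=> 0); have B0 : 0 <= B := dmax_ge0 _ _.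
have D0 : 0 < K * 1 + B + 1 by rewrite ltr_wpDl // addr_ge0 // mulr_ge0.
set D := K * 1 + B + 1 in D0.
set L := \sum_j `|l j|; have L0 : 0 <= L by exact: sumr_ge0.
exists (`|C| * D ^+ 2 + L * K), (Num.min (Num.min r 1) (rho / D)); split.
- by rewrite addr_ge0 // mulr_ge0 ?exprn_ge0 // ltW.
- by rewrite !lt_min r0 ltr01 divr_gt0.
move=> t t0; rewrite !lt_min -andbA => /and3P[tr t1 tD].
have dc : dmax (c t) y <= D * t.
  apply: dmax_le => [|j]; first by rewrite mulr_ge0 // ltW.
  have := hK t t0 tr j; have : `|w j| <= B by have := le_dmax w (fun=> 0) j; rewrite subr0.
  move=> hw hj; rewrite -[c t j - y j](subrK (t * w j)).
  apply: le_trans (ler_normD _ _) _; rewrite normrM (gtr0_norm t0).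
  have : t * `|w j| <= t * B by rewrite ler_pM2l.
  have : K * t ^+ 2 <= K * 1 * t by rewrite mulr1 expr2 mulrA ler_piMr ?mulr_ge0 // ltW.
  rewrite /D; lra.
have dr : dmax (c t) y <= rho.
  by apply: le_trans dc _; rewrite mulrC -ler_pdivlMr // ltW.
have -> : f (c t) - f y - t * \sum_j l j * w j =
  (f (c t) - f y - \sum_j l j * (c t j - y j)) +
   \sum_j l j * (c t j - y j - t * w j).
  have -> : \sum_j l j * (c t j - y j - t * w j) =
     \sum_j l j * (c t j - y j) - t * \sum_j l j * w j.
    by rewrite mulr_sumr -sumrB; apply: eq_bigr => j _ /=; ring.
  by ring.
apply: le_trans (ler_normD _ _) _; rewrite mulrDl lerD //.
  apply: le_trans (hf _ dr) _.
  apply: le_trans (_ : `|C| * dmax (c t) y ^+ 2 <= _).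
    by rewrite ler_wpM2r ?exprn_ge0 ?dmax_ge0 // ler_norm.
  rewrite -mulrA ler_wpM2l // -exprMn lerXn2r // nnegrE ?dmax_ge0 //.
  by rewrite mulr_ge0 // ltW.
apply: le_trans (ler_norm_sum _ _ _) _; rewrite -mulrA /L mulr_suml; apply: ler_sum => j _.
by rewrite normrM ler_wpM2l // hK.
Qed.

End SecondOrderError.

(** * The 2-jets of approximate solutions *)

Section Compatibility.
Variables (R : realType) (n m k : nat).
Variable F : 'I_m -> Gidx n k -> (FCoord n m k -> R) -> R.
Implicit Types (z v : Coord n m -> R) (A B : 'I_m).

(** [Fproj] is linear, so along the line z + t v the function [fz] is an affine term minus [F] on a
    line with direction [Fproj v], to which the first-order expansion of [F] applies. The formula
    makes [df] visibly linear in [v]. *)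
Lemma df_linear (U : (FCoord n m k -> R) -> Prop) z A (al : Gidx n k) v :
  analytic_at U (F A al) (Fproj z) ->
  df F z A al v = v (inr (A, val al)) -
    \sum_s pderiv (F A al) s (Fproj z) * Fproj v s.
Proof.
move=> /analytic_at_taylor1 /(taylor1_line (Fproj v)) [C [r [r0 hF]]].
rewrite /df /dirderiv; apply: (derive1_of_quadratic_error r0 (C := C)) => t ht.
apply: le_trans (hF t ht); rewrite -normrN.
have -> : (fun s => z s + 0 * v s) = z by apply: funext => s; rewrite mul0r addr0.
rewrite /fz /zpp.
have -> : Fproj (fun s => z s + t * v s) = (fun s => Fproj (k := k) z s + t * Fproj v s).
  by apply: funext => -[[?|?]|[? ?]].
by rewrite le_eqVlt; apply/orP; left; apply/eqP; congr (`|_|); ring.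
Qed.

(* [d/dx^i + p_i d/dp + q_ij d/dp_j], the lift of [d/dx^i] to the tangent
   space of a 2-jet with Hessian [q]. *)
Definition lift_dx z (q : 'I_m -> 'I_n -> 'I_n -> R) (i : 'I_n) : Coord n m -> R :=
  fun s => match s with
  | inl (inl j) => if j == i then 1 else 0
  | inl (inr A) => zpp z A i
  | inr (A, j) => q A i j
  end.

Definition extend0 (v : Lidx n k -> R) (i : 'I_n) : R :=
  match (insub i : option (Lidx n k)) with Some L => v L | None => 0 end.

Lemma extend0_delta (L : Lidx n k) :
  extend0 (fun G => if G == L then 1 else 0) = (fun i => if i == val L then 1 else 0).
Proof.
apply: funext => i; rewrite /extend0; case: insubP => [G _ <-|hi]; first by rewrite -val_eqE.
by case: eqP => // e; rewrite e (valP L) in hi.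
Qed.

Lemma extend0D (v w : Lidx n k -> R) i : extend0 (fun L => v L + w L) i = extend0 v i + extend0 w i.
Proof. by rewrite /extend0; case: insub => //; rewrite addr0. Qed.

(** Along each line x_0 + t v of the initial plane, [u] and the data have second-order expansions
    that differ by O(t^3), so the coefficients of t and t^2 agree; polarisation in [v] recovers the
    array. The last clause collects the remainders for [u] and its derivatives with a common
    constant and radius. *)
Lemma jet_matches_data (x0 : 'I_n -> R) (a : R) (p : Lidx n k -> R)
    (s : Lidx n k -> Lidx n k -> R) (u : ('I_n -> R) -> R) W (C r : R) :
  let x0L := fun L : Lidx n k => x0 (val L) in
  symmetric_array s -> real_analytic_on W u -> W x0 -> 0 < r ->
  (forall y : Lidx n k -> R, dmax y x0L < r ->
    `|u (fun i => match (insub i : option (Lidx n k)) with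
                  | Some L => y L | None => x0 i end)
      - quad a p s (fun L => y L - x0L L)| <= C * dmax y x0L ^+ 3) ->
  exists q : 'I_n -> 'I_n -> R, [/\ symmetric_array q,
    u x0 = a, forall L : Lidx n k, pderiv u (val L) x0 = p L,
    forall L G : Lidx n k, q (val L) (val G) = s L G &
    exists K rho : R, [/\ 0 <= K, 0 < rho &
     forall x, dmax x x0 <= rho ->
      `|u x - u x0 - \sum_i pderiv u i x0 * (x i - x0 i)| <= K * dmax x x0 ^+ 2 /\
      forall i, `|pderiv u i x - (pderiv u i x0 + \sum_j q i j * (x j - x0 j))|
         <= K * dmax x x0 ^+ 2]].
Proof.
move=> x0L ss hu Wx r0 hd.
have [q [K [rho [qs K0 rho0 hq]]]] := real_analytic_taylor2 hu Wx.
have ext (v : Lidx n k -> R) (t : R) : (fun i => match (insub i : option (Lidx n k)) with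
    | Some L => x0L L + t * v L | None => x0 i end) = (fun i => x0 i + t * extend0 v i).
  by apply: funext => i; rewrite /extend0; case: insubP => [L _ <-|_] //; rewrite mulr0 addr0.
have u0 : u x0 = a.
  have := hd x0L; rewrite dmaxxx expr0n mulr0 => /(_ r0).
  have -> : (fun i => match (insub i : option (Lidx n k)) with
    | Some L => x0L L | None => x0 i end) = x0.
    by apply: funext => i; case: insubP => [L _ <-|].
  have -> : (fun L => x0L L - x0L L) = (fun=> 0) by apply: funext => L; rewrite subrr.
  by rewrite quad0 normr_le0 subr_eq0 => /eqP.
have quad_scale (J : finType) (b : R) (l : J -> R) (w : J -> J -> R) (v : J -> R) (t : R) :
   quad b l w (fun j => t * v j) =
   b + t * \sum_j l j * v j + t ^+ 2 * (2^-1 * \sum_i \sum_j w i j * v i * v j).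
  rewrite /quad; have -> : \sum_j l j * (t * v j) = t * \sum_j l j * v j.
    by rewrite mulr_sumr; apply: eq_bigr => j _; ring.
  have -> : \sum_i \sum_j w i j * (t * v i) * (t * v j) =
     t ^+ 2 * \sum_i \sum_j w i j * v i * v j.
    rewrite mulr_sumr; apply: eq_bigr => i _; rewrite mulr_sumr.
    by apply: eq_bigr => j _; ring.
  by ring.
have main (v : Lidx n k -> R) :
   \sum_i pderiv u i x0 * extend0 v i = \sum_L p L * v L /\
   \sum_i \sum_j q i j * extend0 v i * extend0 v j = \sum_L \sum_G s L G * v L * v G.
  set a1 := \sum_i pderiv u i x0 * _; set b1 := \sum_L p L * _.
  set a2 := \sum_i \sum_j q i j * _ * _; set b2 := \sum_L \sum_G s L G * _ * _.
  set M := dmax (extend0 v) (fun=> 0) + dmax v (fun=> 0).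
  have M1 : dmax (extend0 v) (fun=> 0) <= M by rewrite lerDl dmax_ge0.
  have M2 : dmax v (fun=> 0) <= M by rewrite lerDr dmax_ge0.
  have M0 : 0 <= M by apply: le_trans M1; exact: dmax_ge0.
  have Mp : 0 < M + 1 by rewrite ltr_wpDl.
  have cubic : exists D r' : R, [/\ 0 <= D, 0 < r' & forall t, 0 < t -> t < r' ->
      `|t * (a1 - b1) + t ^+ 2 * (2^-1 * (a2 - b2))| <= D * t ^+ 3].
    exists ((`|C| + K) * M ^+ 3), (Num.min (r / (M + 1)) (rho / (M + 1))).
    split; first by rewrite mulr_ge0 ?exprn_ge0 // addr_ge0.
      by rewrite lt_min !divr_gt0.
    move=> t t0; rewrite lt_min !ltr_pdivlMr // => /andP[tr trho].
    have h1 := dmax_shift x0 (extend0 v) t; have h2 := dmax_shift x0L v t.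
    rewrite (gtr0_norm t0) in h1 h2.
    have h1' : dmax (fun i => x0 i + t * extend0 v i) x0 <= t * M.
      by apply: le_trans h1 _; rewrite ler_pM2l.
    have h2' : dmax (fun L => x0L L + t * v L) x0L <= t * M.
      by apply: le_trans h2 _; rewrite ler_pM2l.
    have tM : t * M <= t * (M + 1) by rewrite ler_pM2l //; lra.
    have [_ e1 _] := hq _ (le_trans h1' (le_trans tM (ltW trho))).
    have := hd _ (le_lt_trans h2' (le_lt_trans tM tr)).
    rewrite ext => e2.
    have E1 : (fun i => x0 i + t * extend0 v i - x0 i) = (fun i => t * extend0 v i).
      by apply: funext => i; ring.
    have E2 : (fun L => x0L L + t * v L - x0L L) = (fun L => t * v L).
      by apply: funext => i; ring.
    rewrite E1 quad_scale -/a1 -/a2 in e1; rewrite E2 quad_scale -/b1 -/b2 in e2.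
    have e1' := le_trans e1 (ler_wpM2l K0 (lerXn2r 3 (dmax_ge0 _ _) (mulr_ge0 (ltW t0) M0) h1')).
    have e2' : C * dmax (fun L => x0L L + t * v L) x0L ^+ 3 <= `|C| * (t * M) ^+ 3.
      apply: le_trans (_ : `|C| * dmax (fun L => x0L L + t * v L) x0L ^+ 3 <= _).
        by rewrite ler_wpM2r ?exprn_ge0 ?dmax_ge0 // ler_norm.
      by rewrite ler_wpM2l // lerXn2r // nnegrE ?dmax_ge0 // mulr_ge0 // ltW.
    have {e2 e2'} e2 := le_trans e2 e2'.
    set X := u _ in e1' e2.
    have -> : t * (a1 - b1) + t ^+ 2 * (2^-1 * (a2 - b2)) =
      (X - (a + t * b1 + t ^+ 2 * (2^-1 * b2))) -
      (X - (u x0 + t * a1 + t ^+ 2 * (2^-1 * a2))) by rewrite u0; ring.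
    apply: le_trans (ler_normB _ _) _.
    by apply: le_trans (lerD e2 e1') _; rewrite le_eqVlt; apply/orP; left; apply/eqP; ring.
  have [D [r' [D0 r'0 hD]]] := cubic.
  (* The quadratic term is first counted as part of an O(t^2) error. Once the linear coefficients
     agree, dividing the cubic bound by t isolates the quadratic one. *)
  have E1 : a1 - b1 = 0.
    apply: O2_linear_eq0.
    exists (`|2^-1 * (a2 - b2)| + D), (Num.min r' 1).
    split; rewrite ?addr_ge0 ?lt_min ?r'0 ?ltr01 // => t t0; rewrite lt_min => /andP[tr t1].
    have := hD t t0 tr; set X := 2^-1 * _ => e.
    have -> : t * (a1 - b1) = (t * (a1 - b1) + t ^+ 2 * X) - t ^+ 2 * X by ring.
    apply: le_trans (ler_normB _ _) _.
    rewrite mulrDl addrC lerD //.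
      by rewrite normrM [`|t ^+ 2|]ger0_norm ?exprn_ge0 ?(ltW t0) // mulrC.
    apply: le_trans e _; rewrite ler_wpM2l // exprS ler_piMl ?exprn_ge0 ?(ltW t0) //.
    exact: ltW.
  split; apply/eqP; rewrite -subr_eq0; first by rewrite E1.
  have : 2^-1 * (a2 - b2) = 0.
    apply: O2_linear_eq0; exists D, r'; split=> // t t0 tr.
    have := hD t t0 tr; rewrite E1 mulr0 add0r [t ^+ 2]expr2 -mulrA normrM (gtr0_norm t0).
    by rewrite [t ^+ 3]exprS [X in _ <= X]mulrCA ler_pM2l.
  by move=> /eqP; rewrite mulf_eq0 invr_eq0 pnatr_eq0.
exists q; split=> //.
- by move=> L; have [] := main (fun G => if G == L then 1 else 0); rewrite extend0_delta !sum_delta.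
- have B1 (J : finType) (w : J -> J -> R) i j :
    \sum_a \sum_b w a b * (if a == i then 1 else 0) * (if b == j then 1 else 0) = w i j.
    under eq_bigr do rewrite sum_delta.
    by rewrite sum_delta.
  move=> L G.
  have [_] := main (fun H => if H == L then 1 else 0); rewrite extend0_delta !B1 => eL.
  have [_] := main (fun H => if H == G then 1 else 0); rewrite extend0_delta !B1 => eG.
  (* Polarisation: the quadratic form is evaluated at the sum of two coordinate vectors, and the two
     diagonal values [eL] and [eG] are subtracted. *)
  have [_] := main (fun H => (if H == L then 1 else 0) + (if H == G then 1 else 0)).
  have BD (J : finType) (w : J -> J -> R) (f g : J -> R) :
     \sum_a \sum_b w a b * (f a + g a) * (f b + g b) =
     \sum_a \sum_b w a b * f a * f b + \sum_a \sum_b w a b * f a * g b +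
     (\sum_a \sum_b w a b * g a * f b + \sum_a \sum_b w a b * g a * g b).
    rewrite -!big_split; apply: eq_bigr => c _; rewrite -!big_split.
    by apply: eq_bigr => d _ /=; ring.
  under eq_bigr do under eq_bigr do rewrite !extend0D !extend0_delta.
  rewrite !BD !B1 eL eG [q (val G) _]qs [s G L]ss; lra.
have [K' [rho' [rho'0 h1]]] := analytic_at_taylor1 (proj2 hu _ Wx).
exists (K + `|K'|), (Num.min rho rho'); split; rewrite ?addr_ge0 ?lt_min ?rho0 //.
move=> x; rewrite le_min => /andP[hx hx']; split.
  apply: le_trans (h1 _ hx') _; rewrite ler_wpM2r ?exprn_ge0 ?dmax_ge0 //.
  by rewrite ler_wpDl // ler_norm.
move=> i; have [_ _ /(_ i) h] := hq _ hx; apply: le_trans h _.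
by rewrite ler_wpM2r ?exprn_ge0 ?dmax_ge0 // lerDl.
Qed.

(** The initial data are the quadratic polynomials with Hessian [s], and [q] is the Hessian of the
    resulting approximate solution. Since that solution satisfies the equations up to O(|x -
    x_0|^2), their derivatives at x_0 vanish in every direction d/dx^i. *)
Lemma approx_solvable_jet (U : (FCoord n m k -> R) -> Prop) z
    (s : 'I_m -> Lidx n k -> Lidx n k -> R) :
  (forall A al, analytic_at U (F A al) (Fproj z)) ->
  approx_solvable F (zx z) (zp z) (fun B (L : Lidx n k) => zpp z B (val L)) ->
  (forall A al, fz F A al z = 0) -> (forall A, symmetric_array (s A)) ->
  exists q : 'I_m -> 'I_n -> 'I_n -> R,
    [/\ forall A, symmetric_array (q A),
        forall A (L G : Lidx n k), q A (val L) (val G) = s A L G &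
        forall i A al, df F z A al (lift_dx z q i) = 0].
Proof.
move=> hF hsolv hf ss; set x0 := zx z in hsolv *.
pose a A (y : Lidx n k -> R) : R :=
  quad (zp z A) (fun L => zpp z A (val L)) (s A) (fun L => y L - x0 (val L)).
have [||A L|u [[W [Wx hu]] [[C1 [r1 [r10 h1]]] [C2 [r2 [r20 h2]]]]]] := hsolv a.
- by exists (fun=> True); split=> // A; apply: real_analytic_quad.
- move=> A; have e : (fun L : Lidx n k => x0 (val L) - x0 (val L)) = (fun=> 0).
    by apply: funext => L; rewrite subrr.
  by rewrite /a e quad0.
- by rewrite /a pderiv_quad.
have /choice [q hq] := fun A => jet_matches_data (ss A) (hu A) Wx r20 (fun y hy => h2 y hy A).
have u0 A : u A x0 = zp z A by case: (hq A).
have uL A (L : Lidx n k) : pderiv (u A) (val L) x0 = zpp z A (val L).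
  by have [_ _ h _ _] := hq A; exact: h.
have w0 : Fpt x0 (fun B => u B x0) (fun B (G : Lidx n k) => pderiv (u B) (val G) x0) = Fproj z.
  by apply: funext => -[[i|B]|[B G]] /=; rewrite ?u0 ?uL.
have ual A (al : Gidx n k) : pderiv (u A) (val al) x0 = zpp z A (val al).
  have := h1 x0; rewrite dmaxxx expr0n mulr0 => /(_ r10 A al).
  rewrite w0 normr_le0 subr_eq0 => /eqP ->.
  by apply/eqP; rewrite eq_sym -subr_eq0; apply/eqP; exact: hf.
have ui A i : pderiv (u A) i x0 = zpp z A i.
  have [hi|hi] := ltnP i k; first exact: (uL A (exist _ i hi)).
  exact: (ual A (exist _ i hi)).
exists q; split; [by move=> A; case: (hq A)|by move=> A; case: (hq A)|].
move=> i A al; rewrite (df_linear _ (hF A al)) /=.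
pose x (t : R) j : R := x0 j + t * (if j == i then 1 else 0).
have dx t : 0 < t -> dmax (x t) x0 <= t.
  move=> t0; apply: dmax_le => [|j]; first exact: ltW.
  rewrite /x addrAC subrr add0r; case: eqP; rewrite ?mulr0 ?normr0 ?mulr1 => *; first by rewrite ger0_norm // ltW.
  exact: ltW.
have xsum (g : 'I_n -> R) t : \sum_j g j * (x t j - x0 j) = t * g i.
  rewrite -(sum_delta g i) mulr_sumr; apply: eq_bigr => j _; rewrite /x.
  by rewrite [x0 j + _]addrC addrK mulrCA.
have O2u B : O2 (fun t => u B (x t) - zp z B - t * zpp z B i) /\
    forall j, O2 (fun t => pderiv (u B) j (x t) - zpp z B j - t * q B j i).
  have [_ _ _ _ [K [rho [K0 rho0 hK]]]] := hq B.
  have sq t : 0 < t -> K * dmax (x t) x0 ^+ 2 <= K * t ^+ 2.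
    by move=> t0; rewrite ler_wpM2l // lerXn2r ?nnegrE ?dmax_ge0 ?(ltW t0) // dx.
  split=> [|j]; exists K, rho; split=> // t t0 tr;
    have [e1 e2] := hK _ (le_trans (dx t t0) (ltW tr)); apply: le_trans (sq t t0).
    by rewrite xsum u0 ui in e1.
  by have := e2 j; rewrite xsum ui opprD addrA.
(* The argument of [F] along x_0 + t d/dx^i. By the symmetry of [q] its velocity at t = 0 is the
   projection of the lift of d/dx^i. *)
pose c (t : R) : FCoord n m k -> R :=
  Fpt (x t) (fun B => u B (x t)) (fun B (G : Lidx n k) => pderiv (u B) (val G) (x t)).
have Oc s' : O2 (fun t => c t s' - Fproj z s' - t * Fproj (lift_dx z q i) s').
  case: s' => [[j|B]|[B G]] /=.
  - exists 0, 1; split=> // t _ _.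
    change (`|x0 j + t * (if j == i then 1 else 0) - x0 j -
      t * (if j == i then 1 else 0)| <= 0 * t ^+ 2).
    by rewrite [x0 j + _]addrC addrK subrr normr0 mul0r.
  - by case: (O2u B).
  - have [_ /(_ (val G))] := O2u B.
    have [qs _ _ _ _] := hq B.
    by rewrite /zpp /= qs.
have OF := taylor1_curve (analytic_at_taylor1 (hF A al)) Oc.
have O1 : O2 (fun t => pderiv (u A) (val al) (x t) - F A al (c t)).
  exists `|C1|, r1; split=> // t t0 tr.
  apply: le_trans (h1 _ (le_lt_trans (dx t t0) tr) A al) _.
  apply: le_trans (_ : `|C1| * dmax (x t) x0 ^+ 2 <= _).
    by rewrite ler_wpM2r ?exprn_ge0 ?dmax_ge0 // ler_norm.
  by rewrite ler_wpM2l // lerXn2r ?nnegrE ?dmax_ge0 ?(ltW t0) // dx.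
have [_ /(_ (val al)) Oal] := O2u A.
(* The error of the equation, plus the remainder of [F] along [c], minus the remainder of u_alpha,
   is exactly t times the value to be shown zero: the constant terms cancel because [fz] vanishes at
   [z]. *)
apply: O2_linear_eq0.
apply: O2_ext (O2D (O2D O1 OF) (O2N Oal)) => t /=.
have [qs _ _ _ _] := hq A; rewrite (qs i).
have := hf A al; rewrite /fz => /eqP; rewrite subr_eq0 => /eqP ->.
by ring.
Qed.

End Compatibility.

(** * Solvability of linear systems deduced from injectivity *)

Section LinearSystems.
Variable R : realType.

Lemma square_system_solvable (I : finType) (M : I -> I -> R) :
  (forall x : I -> R, (forall i, \sum_j M i j * x j = 0) -> forall j, x j = 0) ->
  forall c : I -> R, exists x : I -> R, forall i, \sum_j M i j * x j = c i.
Proof.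
move=> inj c.
pose A : 'M[R]_#|I| := \matrix_(a, b) M (enum_val a) (enum_val b).
have sumE (x : 'cV[R]_#|I|) i :
    \sum_j M i j * x (enum_rank j) 0 = (A *m x) (enum_rank i) 0.
  rewrite mxE (reindex (@enum_rank I)) /=; last first.
    by exists enum_val => ? _; rewrite ?enum_rankK ?enum_valK.
  by apply: eq_bigr => j _; rewrite mxE !enum_rankK.
have Au : A \in unitmx.
  rewrite -unitmx_tr -row_free_unit; apply: inj_row_free => v hv.
  apply/rowP => b; rewrite mxE -(enum_valK b).
  have /= := inj (fun j => v^T (enum_rank j) 0) _ (enum_val b).
  rewrite mxE; apply => i; rewrite sumE.
  by rewrite -[A]trmxK -trmx_mul hv trmx0 mxE.
exists (fun j => (invmx A *m \col_a c (enum_val a)) (enum_rank j) 0) => i.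
by rewrite sumE mulKVmx // mxE enum_rankK.
Qed.

Lemma functional_sum (I : finType) (J : Type) (f : (J -> R) -> R)
    (x : I -> R) (u : I -> J -> R) :
  (forall a v w, f (fun s => a * v s + w s) = a * f v + f w) ->
  f (fun s => \sum_j x j * u j s) = \sum_j x j * f (u j).
Proof.
move=> flin.
have f0 : f (fun=> 0) = 0.
  have e : f (fun=> 0) = f (fun s : J => -1 * 0 + 0).
    by congr f; apply: funext => s; rewrite mulr0 addr0.
  by rewrite e (flin (-1) (fun=> 0) (fun=> 0)); ring.
have H (r : seq I) : f (fun s => \sum_(j <- r) x j * u j s) = \sum_(j <- r) x j * f (u j).
  elim: r => [|j r IH].
    by rewrite big_nil -[RHS]f0; congr f; apply: funext => s; rewrite big_nil.
  by rewrite big_cons -IH -flin; congr f; apply: funext => s; rewrite big_cons.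
exact: H.
Qed.

(** Replaces a dimension count on [Z]. Elements u_j of [Z] dual to the functionals [p] span a
    subspace whose coordinates are the p_i; there the vanishing of all [mu] forces the vanishing of
    all [p], so the square matrix mu_i(u_j) is injective, hence onto. *)
Lemma linear_family_solvable (I : finType) (J : Type) (Z : (J -> R) -> Prop)
    (p mu : I -> (J -> R) -> R) :
  Z (fun=> 0) ->
  (forall a u v, Z u -> Z v -> Z (fun s => a * u s + v s)) ->
  (forall i a u v, p i (fun s => a * u s + v s) = a * p i u + p i v) ->
  (forall i a u v, mu i (fun s => a * u s + v s) = a * mu i u + mu i v) ->
  (forall x : I -> R, exists u, Z u /\ forall i, p i u = x i) ->
  (forall u, Z u -> (forall i, mu i u = 0) -> forall i, p i u = 0) ->
  forall c : I -> R, exists u, Z u /\ forall i, mu i u = c i.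
Proof.
move=> Z0 Zlin plin mulin /= surj inj c.
have /choice [u hu] := fun j => surj (fun i => if i == j then 1 else 0).
have Zsum (x : I -> R) (r : seq I) : Z (fun s => \sum_(j <- r) x j * u j s).
  elim: r => [|j r IH].
    by rewrite (_ : (fun s => _) = (fun=> 0)) //; apply: funext => s; rewrite big_nil.
  rewrite (_ : (fun s => _) = (fun s => x j * u j s + \sum_(j <- r) x j * u j s)).
    by apply: Zlin => //; case: (hu j).
  by apply: funext => s; rewrite big_cons.
have [|x hx] := @square_system_solvable I (fun i j => mu i (u j)) _ c.
- move=> x hx j.
  have := inj _ (Zsum x (index_enum I)) _ j.
  rewrite (functional_sum (f := p j)) //.
  rewrite (eq_bigr (fun i => x i * (if i == j then 1 else 0))); last first.
    by move=> i _; have [_ ->] := hu i; rewrite eq_sym.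
  rewrite sum_delta; apply => i; rewrite (functional_sum (f := mu i)) //.
  by rewrite -[RHS](hx i); apply: eq_bigr => s _; rewrite mulrC.
exists (fun s => \sum_j x j * u j s); split=> // i.
by rewrite (functional_sum (f := mu i)) // -hx; apply: eq_bigr => j _; rewrite mulrC.
Qed.

End LinearSystems.

(** * The symbol of the system and noncharacteristic frames *)

Section Symbol.
Variables (R : realType) (n m k : nat).

Definition vert (W : 'I_m * 'I_n -> R) : Coord n m -> R :=
  fun s => match s with inl _ => 0 | inr p => W p end.

Variable D : 'I_m -> Gidx n k -> (Coord n m -> R) -> R.
Hypothesis Dlin : forall A al a u v, D A al (fun s => a * u s + v s) = a * D A al u + D A al v.
Variable Phi : 'I_m -> Gidx n k -> 'I_m * Lidx n k -> R.
Hypothesis Dvert : forall A al W, D A al (vert W) =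
  W (A, val al) - \sum_s Phi A al s * W (s.1, val s.2).

(** The symbol, or tableau, of the first-order system: the vertical vectors w_j d/dp_j in the kernel
    of all [D A al]. *)
Definition in_symbol (W : 'I_m * 'I_n -> R) := forall A al, D A al (vert W) = 0.

Definition pairing (W : 'I_m * 'I_n -> R) (y : 'I_n -> R) A := \sum_i W (A, i) * y i.

Lemma vert_lin a U W : vert (fun s => a * U s + W s) = (fun s => a * vert U s + vert W s).
Proof. by apply: funext => -[s|s] //=; rewrite mulr0 addr0. Qed.

Lemma in_symbol0 : in_symbol (fun=> 0).
Proof. by move=> A al; rewrite Dvert big1 ?subr0 // => s _; rewrite mulr0. Qed.

Lemma in_symbol_lin a U W : in_symbol U -> in_symbol W ->
  in_symbol (fun s => a * U s + W s).
Proof. by move=> hU hW A al; rewrite vert_lin Dlin hU hW mulr0 addr0. Qed.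

Lemma in_symbol_sum (J : finType) (c : J -> R) (W : J -> 'I_m * 'I_n -> R) :
  (forall j, in_symbol (W j)) -> in_symbol (fun s => \sum_j c j * W j s).
Proof.
move=> hW.
have H (r : seq J) : in_symbol (fun s => \sum_(j <- r) c j * W j s).
  elim: r => [|j r IH].
    rewrite (_ : (fun s => _) = (fun=> 0)); first exact: in_symbol0.
    by apply: funext => s; rewrite big_nil.
  rewrite (_ : (fun s => _) = (fun s => c j * W j s + \sum_(j <- r) c j * W j s)).
    exact: in_symbol_lin.
  by apply: funext => s; rewrite big_cons.
exact: H.
Qed.

Lemma pairing_lin a U W y A :
  pairing (fun s => a * U s + W s) y A = a * pairing U y A + pairing W y A.
Proof. by rewrite /pairing mulr_sumr -big_split; apply: eq_bigr => i _ /=; ring. Qed.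

(** The equations of the symbol are solved for the alpha-components, so the Lambda-components can be
    chosen freely. *)
Lemma in_symbol_ext (x : 'I_m * Lidx n k -> R) : exists W, in_symbol W /\
  forall A (L : Lidx n k), W (A, val L) = x (A, L).
Proof.
pose W (p : 'I_m * 'I_n) : R := match (insub p.2 : option (Lidx n k)) with
  | Some L => x (p.1, L)
  | None => match (insub p.2 : option (Gidx n k)) with
            | Some al => \sum_s Phi p.1 al s * x s | None => 0 end end.
have WL A (L : Lidx n k) : W (A, val L) = x (A, L) by rewrite /W /= valK.
exists W; split=> // A al; rewrite Dvert.
have -> : W (A, val al) = \sum_s Phi A al s * x s.
  rewrite /W /=; case: insubP => [L hL _|_]; last by rewrite valK.
  by have := valP al; rewrite leqNgt hL.
by apply/eqP; rewrite subr_eq0; apply/eqP; apply: eq_bigr => -[B L] _; rewrite WL.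
Qed.

(* [Y L] is thought of as close to [d/dx^L]. *)
Variable Y : Lidx n k -> 'I_n -> R.

(** Injectivity on the symbol of the contraction with the frame [Y]. For Y_L = d/dx^L it holds
    because the Lambda-components determine [W]. *)
Definition noncharacteristic := forall W, in_symbol W ->
  (forall A L, pairing W (Y L) A = 0) -> forall s, W s = 0.

(** If all pairings vanish, each W_Lambda equals minus the contraction of [W] with the small
    deviation of [Y] from the coordinate frame. Bounding all components by (1 + C) S, where [S] is
    the sum of the |W_Lambda|, and summing gives S <= theta S with theta < 1, hence S = 0. *)
Lemma noncharacteristic_small (C e : R) : 0 <= C -> 0 <= e ->
  (forall A al s, `|Phi A al s| <= C) ->
  (forall L i, `|Y L i - (if i == val L then 1 else 0)| <= e) ->
  (#|{: 'I_m * Lidx n k}|)%:R * (n%:R * (e * (1 + C))) < 1 -> noncharacteristic.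
Proof.
move=> C0 e0 hPhi hY small W hW hp.
set S := \sum_(s : 'I_m * Lidx n k) `|W (s.1, val s.2)|.
have S0 : 0 <= S by exact: sumr_ge0.
have WS (A : 'I_m) (i : 'I_n) : `|W (A, i)| <= (1 + C) * S.
  have [hi|hi] := ltnP i k.
    apply: le_trans (_ : S <= _); last by rewrite mulrDl mul1r lerDl mulr_ge0.
    rewrite /S (bigD1 (A, exist _ i hi)) //= lerDl; exact: sumr_ge0.
  have := hW A (exist _ i hi); rewrite Dvert => /eqP; rewrite subr_eq0 => /eqP /= ->.
  apply: le_trans (ler_norm_sum _ _ _) _.
  apply: le_trans (_ : C * S <= _); last by rewrite mulrDl mul1r lerDr.
  by rewrite mulr_sumr; apply: ler_sum => s _; rewrite normrM ler_wpM2r.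
have WL (A : 'I_m) (L : Lidx n k) : `|W (A, val L)| <= n%:R * (e * (1 + C)) * S.
  have := hp A L; rewrite /pairing.
  have -> : \sum_i W (A, i) * Y L i = W (A, val L) +
      \sum_i W (A, i) * (Y L i - (if i == val L then 1 else 0)).
    rewrite -{1}(sum_delta (fun i => W (A, i)) (val L)) -big_split.
    by apply: eq_bigr => i _ /=; rewrite mulrBr addrC subrK.
  move=> /eqP; rewrite addr_eq0 => /eqP ->; rewrite normrN.
  apply: le_trans (ler_norm_sum _ _ _) _.
  apply: le_trans (_ : \sum_(i < n) e * ((1 + C) * S) <= _); last first.
    rewrite big_const_ord iter_addr_0 -[leLHS]mulr_natl.
    by rewrite le_eqVlt; apply/orP; left; apply/eqP; ring.
  by apply: ler_sum => i _; rewrite normrM mulrC ler_pM.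
have : S <= (#|{: 'I_m * Lidx n k}|)%:R * (n%:R * (e * (1 + C))) * S.
  rewrite -mulrA mulr_natl -sumr_const /S; apply: ler_sum => -[A L] _; exact: WL.
move=> hS; have S00 : S = 0.
  apply/eqP; rewrite eq_le S0 andbT leNgt; apply/negP => Sp.
  by move: hS; rewrite leNgt => /negP; apply; rewrite gtr_pMl.
move=> [A i]; apply/eqP; rewrite -normr_eq0 eq_le normr_ge0 andbT.
by apply: le_trans (WS A i) _; rewrite S00 mulr0.
Qed.

Hypothesis nonchar : noncharacteristic.

(** The Lambda-components are onto by [in_symbol_ext], and the equally many pairings with [Y] are
    injective on the symbol. *)
Lemma pairing_surjective (N : 'I_m -> Lidx n k -> R) :
  exists W, in_symbol W /\ forall A L, pairing W (Y L) A = N A L.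
Proof.
have [|||||| W [hW hp]] := @linear_family_solvable R _ _ in_symbol
  (fun (s : 'I_m * Lidx n k) W => W (s.1, val s.2))
  (fun s W => pairing W (Y s.2) s.1) _ _ _ _ _ _ (fun s => N s.1 s.2).
- exact: in_symbol0.
- exact: in_symbol_lin.
- by [].
- by move=> i a u v; rewrite pairing_lin.
- by move=> x; have [W [h e]] := in_symbol_ext x; exists W; split=> // -[A L]; rewrite e.
- by move=> W hW h s; apply: nonchar => // A L; apply: (h (A, L)).
by exists W; split=> // A L; apply: (hp (A, L)).
Qed.

Variable z : Coord n m -> R.
Hypothesis jets : forall s : 'I_m -> Lidx n k -> Lidx n k -> R,
  (forall A, symmetric_array (s A)) ->
  exists q : 'I_m -> 'I_n -> 'I_n -> R,
    [/\ forall A, symmetric_array (q A),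
        forall A (L G : Lidx n k), q A (val L) (val G) = s A L G &
        forall i A al, D A al (lift_dx z q i) = 0].

Let bil (q : ('I_m * 'I_n) * 'I_n -> R) A (u v : 'I_n -> R) :=
  \sum_i \sum_j u i * q (A, i, j) * v j.

(* The 2-jets of [jets] are prescribed on [d/dx^L], [L < k]; being
   noncharacteristic lets us prescribe them on the nearby frame [Y] instead. *)
Lemma jet_prescribed (N : 'I_m -> Lidx n k -> Lidx n k -> R) :
  (forall A, symmetric_array (N A)) ->
  exists q : 'I_m -> 'I_n -> 'I_n -> R,
    [/\ forall A, symmetric_array (q A),
        forall A L G, \sum_i \sum_j Y L i * q A i j * Y G j = N A L G &
        forall i A al, D A al (lift_dx z q i) = 0].
Proof.
move=> Ns.
pose T := ('I_m * (Lidx n k * Lidx n k))%type.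
(* A symmetric array is determined by its entries with L <= G. Indexing by these makes the number of
   unknowns equal to the number of equations. *)
pose I := {s : T | (val s.2.1 <= val s.2.2)%N}.
pose Z (d : ('I_m * 'I_n) * 'I_n -> R) := (forall A i j, d (A, i, j) = d (A, j, i)) /\
  forall i, in_symbol (fun p => d (p.1, i, p.2)).
(* The admissible Hessians form an affine space over [Z]. This one, with zero Lambda-block, is the
   base point, and the solution is sought as q0 + d. *)
have [q0 [q0s q0L q0D]] := jets (s := fun _ _ _ => 0) (fun A L G => erefl).
have bil_sym d A u v : Z d -> bil d A u v = bil d A v u.
  move=> [ds _]; rewrite /bil exchange_big; apply: eq_bigr => i _; apply: eq_bigr => j _.
  by rewrite ds; ring.
(* Contracting one slot of [d] with Y_G gives an element of the symbol that pairs to zero with every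
   Y_L, hence is zero. Then, with one slot frozen at i, [d] itself lies in the symbol and pairs to
   zero with every Y_G. *)
have Zmain d : Z d -> (forall A L G, bil d A (Y L) (Y G) = 0) -> forall s, d s = 0.
  move=> [ds dsym] hb.
  have W0 G A i : \sum_j d (A, i, j) * Y G j = 0.
    pose W (p : 'I_m * 'I_n) := \sum_j Y G j * d (p.1, j, p.2).
    have hW : in_symbol W by apply: (@in_symbol_sum _ _ (fun j p => d (p.1, j, p.2))).
    have WE B j : W (B, j) = \sum_i d (B, j, i) * Y G i.
      by apply: eq_bigr => s _; rewrite ds mulrC.
    rewrite -WE; apply: nonchar => // B L; rewrite -[RHS](hb B L G) /pairing /bil.
    apply: eq_bigr => s _; rewrite WE mulr_suml; apply: eq_bigr => j _; ring.
  by move=> [[A i] j]; apply: (nonchar (dsym i) _ (A, j)) => B L; exact: W0.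
have [|||||| d [hd hmu]] := @linear_family_solvable R I _ Z
  (fun s d => d ((val s).1, val (val s).2.1, val (val s).2.2))
  (fun s d => bil d (val s).1 (Y (val s).2.1) (Y (val s).2.2)) _ _ _ _ _ _
  (fun s => N (val s).1 (val s).2.1 (val s).2.2 -
     \sum_i \sum_j Y (val s).2.1 i * q0 (val s).1 i j * Y (val s).2.2 j).
- by split=> // i; exact: in_symbol0.
- move=> a u v [us usym] [vs vsym]; split=> [A i j|i]; first by rewrite us vs.
  exact: in_symbol_lin.
- by [].
- move=> s a u v; rewrite /bil mulr_sumr -big_split; apply: eq_bigr => i _ /=.
  by rewrite mulr_sumr -big_split; apply: eq_bigr => j _ /=; ring.
- move=> x.
  pose val0 (s : T) : R := match (insub s : option I) with Some i => x i | None => 0 end.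
  (* [val0] is read only at ordered pairs, so its default value 0 never enters. *)
  pose s A (L G : Lidx n k) := if (val L <= val G)%N then val0 (A, (L, G)) else val0 (A, (G, L)).
  have ss A : symmetric_array (s A).
    move=> L G; rewrite /s; case: ltngtP => // e; suff -> : L = G by [].
    by apply: val_inj; apply: val_inj.
  have [q1 [q1s q1L q1D]] := jets ss.
  exists (fun p => q1 p.1.1 p.1.2 p.2 - q0 p.1.1 p.1.2 p.2); split.
    split=> [A i j|i A al] /=; first by rewrite q1s q0s.
    have -> : vert (fun p => q1 p.1 i p.2 - q0 p.1 i p.2) =
       (fun s => -1 * lift_dx z q0 i s + lift_dx z q1 i s).
      by apply: funext => -[[j|B]|[B j]] /=; ring.
    by rewrite Dlin q0D q1D mulr0 addr0.
  move=> i /=; rewrite q0L q1L subr0 /s (valP i) /val0.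
  by case: i => [[A [L G]] h] /=; rewrite insubT.
- move=> d hd hmu s; apply: Zmain => // A L G.
  have [h|h] := leqP (val L) (val G).
    exact: (hmu (exist _ (A, (L, G)) h)).
  rewrite bil_sym //; exact: (hmu (exist _ (A, (G, L)) (ltnW h))).
exists (fun A i j => q0 A i j + d (A, i, j)); case: (hd) => ds dsym; split.
- by move=> A i j; rewrite q0s ds.
- have split_sum A L G : \sum_i \sum_j Y L i * (q0 A i j + d (A, i, j)) * Y G j =
     \sum_i \sum_j Y L i * q0 A i j * Y G j + bil d A (Y L) (Y G).
    rewrite /bil -big_split; apply: eq_bigr => i _ /=; rewrite -big_split.
    by apply: eq_bigr => j _ /=; ring.
  have main A (L G : Lidx n k) : (val L <= val G)%N ->
      \sum_i \sum_j Y L i * (q0 A i j + d (A, i, j)) * Y G j = N A L G.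
    move=> h; rewrite split_sum.
    by rewrite (hmu (exist _ (A, (L, G)) h)) /= addrC subrK.
  move=> A L G; have [h|h] := leqP (val L) (val G); first exact: main.
  rewrite Ns -(main A G L (ltnW h)) exchange_big.
  by apply: eq_bigr => i _; apply: eq_bigr => j _; rewrite q0s ds; ring.
move=> i A al.
have -> : lift_dx z (fun A i j => q0 A i j + d (A, i, j)) i =
  (fun s => 1 * vert (fun p => d (p.1, i, p.2)) s + lift_dx z q0 i s).
  by apply: funext => -[[j|B]|[B j]] /=; ring.
by rewrite Dlin dsym q0D mulr0 addr0.
Qed.

End Symbol.

(** * The differential ideal, evaluated on integral elements and polar spaces *)

Section Forms.
Variables (R : realType) (n m k : nat).
Variable F : 'I_m -> Gidx n k -> (FCoord n m k -> R) -> R.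
Notation V := (Coord n m -> R).
Implicit Types (z v : V) (A : 'I_m) (al : Gidx n k).

Lemma altform_zero d : altform (fun _ : 'I_d -> V => 0 : R).
Proof. by split=> // *; rewrite mulr0 addr0. Qed.

Lemma altform_deg0 (phi : form R n m 0) : altform phi.
Proof. by split=> [vs []|vs []]. Qed.

Lemma wedge1_zero d (th : V -> R) vs : wedge1 th (fun _ : 'I_d -> V => 0 : R) vs = 0.
Proof. by rewrite /wedge1 big1 // => j _; rewrite mulr0. Qed.

Lemma wedge1_vanish d (th : V -> R) (be : form R n m d) vs :
  (forall j, th (vs j) = 0) -> wedge1 th be vs = 0.
Proof. by move=> h; rewrite /wedge1 big1 // => j _; rewrite h mulr0 mul0r. Qed.

(** The tuple that appears unfolded in the definition of [polar]. *)
Definition vcons d v (e : 'I_d -> V) : 'I_d.+1 -> V :=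
  fun j => match unlift ord0 j with Some i => e i | None => v end.

Lemma vcons0 d v (e : 'I_d -> V) : vcons v e ord0 = v.
Proof. by rewrite /vcons unlift_none. Qed.

Lemma vcons_lift d v (e : 'I_d -> V) i : vcons v e (lift ord0 i) = e i.
Proof. by rewrite /vcons liftK. Qed.

Lemma wedge1_vcons d (th : V -> R) (be : form R n m d) v e :
  (forall j, th (e j) = 0) -> wedge1 th be (vcons v e) = th v * be e.
Proof.
move=> h; rewrite /wedge1 big_ord_recl big1 ?addr0 => [|j _].
  rewrite expr0 mul1r vcons0; congr (_ * be _).
  by apply: funext => i; rewrite vcons_lift.
by rewrite vcons_lift h mulr0 mul0r.
Qed.

Lemma omega_part_zero z d : omega_part z (fun _ : 'I_d.+1 -> V => 0 : R).
Proof.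
case: d => [|d] //; exists (fun _ _ => 0); split=> [A|vs]; first exact: altform_zero.
rewrite big1 // => A _; rewrite /Omega_wedge big1 // => i _.
rewrite /wedge1 big1 // => j _; rewrite big1 ?mulr0 // => j' _; by rewrite mulr0.
Qed.

Lemma inI_one_part z d (r : form R n m d) : one_part F z r -> inI F z r.
Proof.
move=> hr; exists (fun _ _ _ => 0), r; split=> [A a|]; first exact: altform_zero.
split=> // vs; rewrite big1 ?add0r // => A _; rewrite big1 // => a _; by rewrite mulr0.
Qed.

Lemma inI_df z d A al (be : form R n m d) : altform be ->
  inI F z (wedge1 (df F z A al) be).
Proof.
move=> hbe; apply: inI_one_part.
exists (fun B a => if (B == A) && (a == al) then be else fun=> 0), (fun _ _ => 0), (fun=> 0).
split; first by move=> B a; case: ifP => // _; exact: altform_zero.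
split; first by move=> B; exact: altform_zero.
split; first exact: omega_part_zero.
move=> vs; rewrite [X in _ + X + _]big1 => [|B _]; last by rewrite wedge1_zero.
rewrite !addr0 (bigD1 A) //= [X in _ + X]big1 ?addr0 => [|B /negbTE ->]; last first.
  by rewrite big1 // => a _; rewrite wedge1_zero.
rewrite (bigD1 al) //= !eqxx big1 ?addr0 // => a /negbTE ->.
by rewrite wedge1_zero.
Qed.

Lemma inI_eta z d A (be : form R n m d) : altform be -> inI F z (wedge1 (eta z A) be).
Proof.
move=> hbe; apply: inI_one_part.
exists (fun _ _ _ => 0), (fun B => if B == A then be else fun=> 0), (fun=> 0).
split; first by move=> B a; exact: altform_zero.
split; first by move=> B; case: ifP => // _; exact: altform_zero.
split; first exact: omega_part_zero.
move=> vs; rewrite big1 => [|B _]; last by rewrite big1 // => a _; rewrite wedge1_zero.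
rewrite add0r addr0 (bigD1 A) //= eqxx big1 ?addr0 // => B /negbTE ->.
by rewrite wedge1_zero.
Qed.

Lemma inI_Omega z d A (de : form R n m d) : altform de -> inI F z (Omega_wedge A de).
Proof.
move=> hde; apply: inI_one_part.
exists (fun _ _ _ => 0), (fun _ _ => 0), (Omega_wedge A de).
split; first by move=> B a; exact: altform_zero.
split; first by move=> B; exact: altform_zero.
split; last first.
  move=> vs; rewrite big1 => [|B _]; last by rewrite big1 // => a _; rewrite wedge1_zero.
  by rewrite big1 ?add0r // => B _; rewrite wedge1_zero.
exists (fun B => if B == A then de else fun=> 0); split.
  by move=> B; case: ifP => // _; exact: altform_zero.
move=> vs; rewrite (bigD1 A) //= eqxx big1 ?addr0 // => B /negbTE ->.
rewrite /Omega_wedge big1 // => i _; rewrite {1}/wedge1 big1 // => j _.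
by rewrite wedge1_zero mulr0.
Qed.

Lemma inI_fz z A al : inI F z (fun _ : 'I_0 -> V => fz F A al z).
Proof.
exists (fun B a _ => ((B == A) && (a == al))%:R), (fun=> 0).
split=> [B a|]; first exact: altform_deg0.
split=> // vs; rewrite addr0 (bigD1 A) //= [X in _ + X]big1 ?addr0 => [|B /negbTE ->].
  rewrite (bigD1 al) //= !eqxx mulr1 big1 ?addr0 // => a /negbTE ->.
  by rewrite mulr0.
by rewrite big1 // => a _; rewrite mulr0.
Qed.

(* Swapping the two removed indices is a sign-reversing involution, which turns
   the sum of [dp_i(v_a) dx^i(v_b)] into half the sum of [Omega(v_a, v_b)]. *)
Lemma Omega_wedge_double d A (de : form R n m d) vs :
  Omega_wedge A de vs *+ 2 = \sum_(a < d.+2) \sum_(b < d.+1)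
    (-1) ^+ (a + b) * Omega A (vs a) (vs (lift a b)) *
    de (fun i => vs (lift a (lift b i))).
Proof.
pose M (u v : V) : R := \sum_(i < n) dpp A i u * dx i v.
pose G (a : 'I_d.+2) (b : 'I_d.+1) := de (fun i => vs (lift a (lift b i))).
pose T (p : 'I_d.+2 * 'I_d.+1) : R :=
  (-1) ^+ (p.1 + p.2) * M (vs p.1) (vs (lift p.1 p.2)) * G p.1 p.2.
have E : Omega_wedge A de vs = \sum_p T p.
  rewrite -(pair_bigA _ (fun a b => T (a, b))) /= /Omega_wedge /wedge1 exchange_big.
  apply: eq_bigr => a _ /=; under eq_bigr do rewrite mulr_sumr.
  rewrite exchange_big; apply: eq_bigr => b _ /=; rewrite /T /M /= mulr_sumr mulr_suml.
  by apply: eq_bigr => i _; rewrite exprD /G; ring.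
have ub (a : 'I_d.+2) (b : 'I_d.+1) : (unbump b a < d.+1)%N.
  by rewrite /unbump; have := ltn_ord a; have := ltn_ord b; case: ltnP; lia.
pose sw (p : 'I_d.+2 * 'I_d.+1) : 'I_d.+2 * 'I_d.+1 := (lift p.1 p.2, Ordinal (ub p.1 p.2)).
have swK : involutive sw.
  move=> [a b]; rewrite /sw /=; congr (_, _); apply: val_inj => /=.
    rewrite /bump /unbump; case: (leqP a b); case: (leqP b a) => /=; lia.
  rewrite /bump /unbump; case: (leqP a b); case: (leqP b a) => /=; lia.
have Tsw p : T p + T (sw p) =
   (-1) ^+ (p.1 + p.2) * Omega A (vs p.1) (vs (lift p.1 p.2)) * G p.1 p.2.
  case: p => a b; rewrite /T /sw /=.
  have -> : lift (lift a b) (Ordinal (ub a b)) = a.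
    by have := congr1 fst (swK (a, b)).
  have -> : G (lift a b) (Ordinal (ub a b)) = G a b.
    rewrite /G; congr de; apply: funext => i; congr vs; apply: val_inj => /=.
    by rewrite [RHS]bumpC.
  have -> : (-1) ^+ (bump a b + unbump b a) = - (-1) ^+ (a + b) :> R.
    rewrite /bump /unbump; case: (leqP a b) => h.
      by rewrite /= subn0 add1n addSn exprS mulN1r addnC.
    rewrite add0n /= -[in RHS](prednK (leq_ltn_trans (leq0n _) h)) addSn exprS mulN1r opprK.
    by rewrite subn1 addnC.
  rewrite /Omega sumrB -/(M (vs a) (vs (lift a b))) -/(M (vs (lift a b)) (vs a)); ring.
rewrite mulr2n E {2}(reindex_inj (inv_inj swK)) /= -big_split.
rewrite -(pair_bigA _ (fun a b => T (a, b) + T (sw (a, b)))) /=.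
by apply: eq_bigr => a _; apply: eq_bigr => b _; rewrite Tsw.
Qed.

Lemma OmegaC A u v : Omega A u v = - Omega A v u.
Proof. by rewrite /Omega -sumrN; apply: eq_bigr => i _; ring. Qed.

(** In the doubled sum only the pairs containing [v] survive. Each occurs twice, with [v] removed
    first or second, and the two terms agree because the change of sign cancels against the
    antisymmetry of [Omega]; so the factor 2 can be divided out. *)
Lemma Omega_wedge_vcons d A (de : form R n m d) v (e : 'I_d.+1 -> V) :
  (forall i j, Omega A (e i) (e j) = 0) ->
  Omega_wedge A de (vcons v e) =
  \sum_(b < d.+1) (-1) ^+ b * Omega A v (e b) * de (fun i => e (lift b i)).
Proof.
move=> h; have : Omega_wedge A de (vcons v e) *+ 2 =
   (\sum_(b < d.+1) (-1) ^+ b * Omega A v (e b) * de (fun i => e (lift b i))) *+ 2.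
  rewrite Omega_wedge_double big_ord_recl mulr2n; congr (_ + _).
    apply: eq_bigr => b _; rewrite add0n vcons0 vcons_lift; congr (_ * de _).
    by apply: funext => i; rewrite vcons_lift.
  apply: eq_bigr => a _; rewrite big_ord_recl big1 ?addr0 => [|b _].
    have -> : lift (lift ord0 a) ord0 = ord0 :> 'I_d.+2 by apply: val_inj.
    rewrite vcons0 vcons_lift OmegaC /= /bump leq0n addn0 exprD expr1 mulN1r mulrNN.
    congr (_ * de _); apply: funext => i.
    have -> : lift (lift ord0 a) (lift ord0 i) = lift ord0 (lift a i) :> 'I_d.+2.
      by apply: val_inj; rewrite /= /bump !leq0n !add1n ltnS addnS.
    by rewrite vcons_lift.
  have -> : lift (lift ord0 a) (lift ord0 b) = lift ord0 (lift a b) :> 'I_d.+2.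
    by apply: val_inj; rewrite /= /bump !leq0n !add1n ltnS addnS.
  by rewrite !vcons_lift h mulr0 mul0r.
by move=> /eqP; rewrite eqr_pMn2r // => /eqP.
Qed.

(** The form dx^{i_1} /\ ... /\ dx^{i_d}, used as a coefficient that takes the value 1 on the chart
    basis. *)
Definition xdet d (idx : 'I_d -> 'I_n) : form R n m d :=
  fun vs => \det (\matrix_(i, j) vs i (inl (inl (idx j)))).

Lemma altform_xdet d (idx : 'I_d -> 'I_n) : altform (xdet idx).
Proof.
split=> [vs j a u w|vs i j ij e]; last first.
  by apply: (determinant_alternate ij) => c; rewrite !mxE e.
rewrite /xdet -[X in _ + X]mul1r; apply: (@determinant_multilinear _ _ _ _ _ j).
- by apply/rowP => c; rewrite !mxE /upd eqxx mul1r.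
- by apply/matrixP => r c; rewrite !mxE /upd eq_sym (negbTE (neq_lift _ _)).
- by apply/matrixP => r c; rewrite !mxE /upd eq_sym (negbTE (neq_lift _ _)).
Qed.

Lemma in_span_basis d (e : 'I_d -> V) j : in_span e (e j).
Proof.
exists (fun i => if i == j then 1 else 0) => s.
by under eq_bigr do rewrite mulrC; rewrite sum_delta.
Qed.

(** The ideal is tested only in degrees 0, 1 and 2, on its generators with constant coefficient
    1. *)
Lemma integral_elementE l z (e : 'I_l -> V) : integral_element F z e ->
  [/\ forall A al, fz F A al z = 0, forall A a, eta z A (e a) = 0,
      forall A al a, df F z A al (e a) = 0 &
      forall A a b, Omega A (e a) (e b) = 0].
Proof.
move=> [_ h].
have one (th : V -> R) : inI F z (wedge1 th (fun _ : 'I_0 -> V => 1 : R)) ->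
    forall a, th (e a) = 0.
  move=> hth a; have := h _ _ hth (fun=> e a) (fun=> in_span_basis e a).
  by rewrite /wedge1 big_ord_recl big_ord0 addr0 expr0 mul1r mulr1.
split.
- by move=> A al; apply: (h _ _ (inI_fz z A al) (fun=> fun=> 0)) => -[].
- by move=> A; apply: one; apply: inI_eta; exact: altform_deg0.
- by move=> A al; apply: one; apply: inI_df; exact: altform_deg0.
move=> A a b.
have := h _ _ (inI_Omega z A (altform_deg0 (fun=> 1))) (vcons (e a) (fun=> e b)).
rewrite Omega_wedge_vcons; last first.
  by move=> _ _; rewrite /Omega big1 // => i _; rewrite subrr.
rewrite big_ord_recl big_ord0 addr0 expr0 mul1r mulr1; apply.
by move=> j; rewrite /vcons; case: unlift => *; exact: in_span_basis.
Qed.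

(** Multiplied by dx^1 /\ ... /\ dx^l, which is 1 on [e], the 1-forms [eta] and [df] yield their own
    values at [v]; for [Omega] the factor dx^a is left out of the product. Conversely, every summand
    of a form of the ideal vanishes on [v], e_1, ..., e_l because its generator factor does. *)
Lemma polarP l z (e : 'I_l -> V) v (hln : (l <= n)%N) :
  (forall A al, fz F A al z = 0) -> (forall A a, eta z A (e a) = 0) ->
  (forall A al a, df F z A al (e a) = 0) ->
  (forall A a b, Omega A (e a) (e b) = 0) ->
  (forall a b, e a (inl (inl (widen_ord hln b))) = (a == b)%:R) ->
  polar F z e v <-> [/\ forall A, eta z A v = 0, forall A al, df F z A al v = 0 &
                        forall A a, Omega A v (e a) = 0].
Proof.
move=> hf heta hdf hOm hx; split=> [hv|[veta vdf vOm] phi].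
  have dete : xdet (widen_ord hln) e = 1.
    by rewrite /xdet (_ : \matrix_(i, j) _ = 1%:M) ?det1 //; apply/matrixP => i j; rewrite !mxE hx.
  split.
  - move=> A; have := hv _ (inI_eta z A (altform_xdet (widen_ord hln))).
    by rewrite -/(vcons v e) wedge1_vcons // dete mulr1.
  - move=> A al; have := hv _ (inI_df z A al (altform_xdet (widen_ord hln))).
    by rewrite -/(vcons v e) wedge1_vcons // dete mulr1.
  (* For [l = 0] there is no [a] to treat; otherwise the coefficient of [Omega] has one degree less
     than the dimension of the element. *)
  case: l e hln hf heta hdf hOm hx hv {dete} => [|l] e hln hf heta hdf hOm hx hv A; first by case.
  move=> a0; have := hv _ (inI_Omega z A (altform_xdet (fun j => widen_ord hln (lift a0 j)))).
  rewrite -/(vcons v e) Omega_wedge_vcons // (bigD1 a0) //= big1 ?addr0 => [|b ba].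
    rewrite /xdet (_ : \matrix_(i, j) _ = 1%:M).
      rewrite det1 mulr1 => /eqP; rewrite mulf_eq0 signr_eq0 /= => /eqP //.
    by apply/matrixP => i j; rewrite !mxE hx (inj_eq lift_inj).
  (* For b different from a0 the vector e_{a0} is still among the arguments, and its row in the
     determinant vanishes because the column of x^{a0} was left out. *)
  have [i hi _] := unlift_some ba.
  rewrite /xdet (expand_det_row _ i) big1 ?mulr0 // => j _.
  by rewrite mxE -hi hx (negbTE (neq_lift _ _)) mul0r.
move=> [ga [r [_ [hr ->]]]]; rewrite big1 ?add0r => [|A _]; last first.
  by rewrite big1 // => al _; rewrite hf mul0r.
case: hr => al [be [om [_ [_ [hom ->]]]]]; rewrite -/(vcons v e).
have all_cons (P : V -> Prop) : P v -> (forall a, P (e a)) -> forall j, P (vcons v e j).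
  by move=> Pv Pe j; rewrite /vcons; case: unlift.
rewrite big1 => [|A _]; last first.
  rewrite big1 // => a _; apply: wedge1_vanish => j.
  by apply: (all_cons (fun w => df F z A a w = 0)).
rewrite big1 => [|A _]; last first.
  by apply: wedge1_vanish => j; apply: (all_cons (fun w => eta z A w = 0)).
rewrite !add0r; case: l e om hom all_cons hOm vOm {heta hdf hx al be r ga phi hln} => [|l] e om hom all_cons hOm vOm.
  exact: hom.
case: hom => de [_ ->]; rewrite big1 // => A _.
rewrite Omega_wedge_vcons // big1 // => b _; by rewrite vOm mulr0 mul0r.
Qed.

End Forms.

(** * Integral elements contained in the tangent plane of a 2-jet *)

Section IntegralElements.
Variables (R : realType) (n m k l : nat).
Hypothesis hkl : (k <= l)%N.
Variable U : (FCoord n m k -> R) -> Prop.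
Variable F : 'I_m -> Gidx n k -> (FCoord n m k -> R) -> R.
Hypothesis hF : forall A al, real_analytic_on U (F A al).
Notation V := (Coord n m -> R).
Implicit Types (z v : V) (A B : 'I_m) (al : Gidx n k) (L G : Lidx n k).

Lemma df_lin z A al a u v : U (Fproj z) ->
  df F z A al (fun s => a * u s + v s) = a * df F z A al u + df F z A al v.
Proof.
move=> Uz; have an := proj2 (hF A al) _ Uz; rewrite !(df_linear _ an).
have -> : \sum_s pderiv (F A al) s (Fproj z) * Fproj (fun s => a * u s + v s) s =
  a * \sum_s pderiv (F A al) s (Fproj z) * Fproj u s +
  \sum_s pderiv (F A al) s (Fproj z) * Fproj v s.
  by rewrite mulr_sumr -big_split; apply: eq_bigr => -[[i|B]|[B L]] _ /=;
     rewrite /zx /zp /zpp; ring.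
by ring.
Qed.

Definition Fsymbol z A al (s : 'I_m * Lidx n k) := pderiv (F A al) (inr s) (Fproj z).

Lemma df_vert z A al W : U (Fproj z) ->
  df F z A al (vert W) = W (A, val al) - \sum_s Fsymbol z A al s * W (s.1, val s.2).
Proof.
move=> Uz; have an := proj2 (hF A al) _ Uz; rewrite (df_linear _ an) /=; congr (_ - _).
rewrite big_sumType /= [X in X + _]big1 ?add0r => [|[i|B] _]; last 2 first.
- by rewrite /= /zx /= mulr0.
- by rewrite /= /zp /= mulr0.
by apply: eq_bigr => -[B L] _.
Qed.

Definition jspan z q (c : 'I_n -> R) : V := fun s => \sum_i c i * lift_dx z q i s.

Lemma jspan_x z q c i : jspan z q c (inl (inl i)) = c i.
Proof.
rewrite /jspan (eq_bigr (fun j => c j * (if j == i then 1 else 0))) ?sum_delta // => j _ /=.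
by rewrite eq_sym.
Qed.

Lemma eta_jspan z q c A : eta z A (jspan z q c) = 0.
Proof.
rewrite /eta /dp /dx; apply/eqP; rewrite subr_eq0; apply/eqP.
by apply: eq_bigr => i _; rewrite jspan_x mulrC.
Qed.

Lemma Omega_jspan z q c d A : (forall B, symmetric_array (q B)) ->
  Omega A (jspan z q c) (jspan z q d) = 0.
Proof.
move=> qs; rewrite /Omega sumrB; apply/eqP; rewrite subr_eq0; apply/eqP.
under eq_bigr do rewrite /dx jspan_x mulr_suml.
under [RHS]eq_bigr do rewrite /dx jspan_x mulr_suml.
rewrite exchange_big; apply: eq_bigr => i _; apply: eq_bigr => j _ /=.
by rewrite qs; ring.
Qed.

Lemma Omega_sub A u v w : (forall i, v (inl (inl i)) = w (inl (inl i))) ->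
  Omega A v u - Omega A w u =
  pairing (fun p => v (inr p) - w (inr p)) (fun i => u (inl (inl i))) A.
Proof.
move=> h; rewrite /Omega /pairing -sumrB; apply: eq_bigr => i _.
by rewrite /dx /dpp h; ring.
Qed.

(** A vector killed by [eta] has its p-part fixed by its x-part, so it differs by a vertical vector
    from the [jspan] vector with the same x-part. The difference is written in the shape to which
    [df_lin] applies. *)
Lemma vert_sub_jspan z q v : (forall A, eta z A v = 0) ->
  vert (fun p => v (inr p) - jspan z q (fun i => v (inl (inl i))) (inr p)) =
  (fun s => -1 * jspan z q (fun i => v (inl (inl i))) s + v s).
Proof.
move=> he; apply: funext => -[[i|A]|p] /=; last by ring.
  by rewrite jspan_x; ring.
have := he A; rewrite /eta /dp => /eqP; rewrite subr_eq0 => /eqP ->.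
have -> : jspan z q (fun i => v (inl (inl i))) (inl (inr A)) = \sum_(i < n) zpp z A i * dx i v.
  by apply: eq_bigr => i _; rewrite mulrC.
by ring.
Qed.

Lemma df_jspan z q c A al : U (Fproj z) ->
  (forall i, df F z A al (lift_dx z q i) = 0) -> df F z A al (jspan z q c) = 0.
Proof.
move=> Uz hq; rewrite /jspan (functional_sum (f := df F z A al)); last first.
  by move=> *; exact: df_lin.
by rewrite big1 // => i _; rewrite hq mulr0.
Qed.

Lemma in_symbol_sub_jspan z q v : U (Fproj z) -> (forall A, eta z A v = 0) ->
  (forall i A al, df F z A al (lift_dx z q i) = 0) -> (forall A al, df F z A al v = 0) ->
  in_symbol (df F z) (fun p => v (inr p) - jspan z q (fun i => v (inl (inl i))) (inr p)).
Proof.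
move=> Uz he hq hv A al; rewrite vert_sub_jspan // df_lin // hv.
by rewrite df_jspan // mulr0 addr0.
Qed.

Lemma eq_jspan z q v : (forall A, eta z A v = 0) ->
  (forall p, v (inr p) - jspan z q (fun i => v (inl (inl i))) (inr p) = 0) ->
  v = jspan z q (fun i => v (inl (inl i))).
Proof.
move=> he hp; apply: funext => s; apply/eqP; rewrite -subr_eq0 addrC -mulN1r.
have /(congr1 (fun f => f s)) /= <- := vert_sub_jspan q he.
by case: s => [s|p] //=; rewrite hp.
Qed.

Definition frame_index L : 'I_l := Ordinal (leq_trans (valP L) hkl).

Definition frame_x (e : 'I_l -> V) a (i : 'I_n) : R := e a (inl (inl i)).

Definition frame_nonchar z (e : 'I_l -> V) :=
  noncharacteristic (df F z) (fun L => frame_x e (frame_index L)).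

Hypothesis hkn : (k < n)%N.

Lemma frame_index_surj (a : 'I_l) : (a < k)%N -> exists L, frame_index L = a.
Proof.
move=> ak; exists (exist _ (Ordinal (ltn_trans ak hkn)) ak).
exact: val_inj.
Qed.

Hypothesis hsolv : forall w, U w ->
     approx_solvable F (fun i => w (inl (inl i))) (fun B => w (inl (inr B)))
                       (fun B L => w (inr (B, L))).

(** The values to prescribe for q(Y_L, Y_G) are the contractions of e_L with Y_G; that they form a
    symmetric array is exactly Omega(e_L, e_G) = 0. Each e_a minus its [jspan] is then in the
    symbol, and it is enough that its pairings with the Y_G vanish. *)
Lemma frame_jet z (e : 'I_l -> V) : U (Fproj z) -> frame_nonchar z e ->
  (forall A al, fz F A al z = 0) -> (forall A a, eta z A (e a) = 0) ->
  (forall A al a, df F z A al (e a) = 0) ->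
  (forall A (a b : 'I_l), (b < k)%N -> (b < a)%N -> Omega A (e a) (e b) = 0) ->
  exists q, [/\ forall A, symmetric_array (q A),
    forall i A al, df F z A al (lift_dx z q i) = 0 &
    forall a, e a = jspan z q (frame_x e a)].
Proof.
move=> Uz nc hf heta hdf hOm.
pose Y L := frame_x e (frame_index L).
pose M A a (y : 'I_n -> R) := \sum_i e a (inr (A, i)) * y i.
have OmE A a b : Omega A (e a) (e b) = M A a (frame_x e b) - M A b (frame_x e a).
  by rewrite /Omega sumrB.
have Om0 A a L : Omega A (e a) (e (frame_index L)) = 0.
  have [h|h|h] := ltngtP (frame_index L) a; first by apply: hOm => //; exact: valP L.
    by rewrite OmegaC hOm ?oppr0 // (ltn_trans h (valP L)).
  by rewrite (_ : a = frame_index L) ?OmE ?subrr //; exact: val_inj.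
have [||q [qs qN qD]] := jet_prescribed (fun A al a u v => df_lin A al a u v Uz)
  (fun A al W => df_vert A al W Uz) nc (z := z) _
  (N := fun A L G => M A (frame_index L) (Y G)).
- move=> s ss; apply: approx_solvable_jet ss => //.
  + by move=> A al; exact: (proj2 (hF A al) _ Uz).
  + exact: (hsolv Uz).
- by move=> A L G; apply/eqP; rewrite -subr_eq0 -OmE Om0.
exists q; split=> //.
have symb a := in_symbol_sub_jspan Uz (fun A => heta A a) qD (fun A al => hdf A al a).
have pairE a A y : pairing (fun p => e a (inr p) - jspan z q (frame_x e a) (inr p)) y A =
    M A a y - \sum_i \sum_j frame_x e a i * q A i j * y j.
  rewrite /pairing exchange_big /M -sumrB; apply: eq_bigr => j _.
  by rewrite mulrBl /jspan mulr_suml.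
have WL L p : e (frame_index L) (inr p) - jspan z q (frame_x e (frame_index L)) (inr p) = 0.
  by apply: (nc _ (symb (frame_index L))) => A G; rewrite pairE qN subrr.
move=> a; apply: eq_jspan => // p; apply: (nc _ (symb a)) => A G; rewrite pairE.
(* Omega(e_a, e_G) = 0 moves the contraction from e_a to e_G, which is already known to be a [jspan]
   vector; the symmetry of [q] then gives the cancellation. *)
have -> : M A a (frame_x e (frame_index G)) = M A (frame_index G) (frame_x e a).
  by apply/eqP; rewrite -subr_eq0 -OmE Om0.
rewrite /M; under eq_bigr => i _.
  have /eqP := WL G (A, i); rewrite subr_eq0 => /eqP ->.
  rewrite /jspan mulr_suml; over.
rewrite -sumrB big1 // => i _ /=; rewrite -sumrB big1 // => j _.
by rewrite qs; ring.
Qed.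

End IntegralElements.

(** * The polar space as a graph over the x-coordinates *)

Section PolarSpace.
Variables (R : realType) (n m k l : nat).
Hypotheses (hkl : (k <= l)%N) (hln : (l <= n)%N).
Variable U : (FCoord n m k -> R) -> Prop.
Variable F : 'I_m -> Gidx n k -> (FCoord n m k -> R) -> R.
Hypothesis hF : forall A al, real_analytic_on U (F A al).
Hypothesis hsolv : forall w, U w ->
     approx_solvable F (fun i => w (inl (inl i))) (fun B => w (inl (inr B)))
                       (fun B L => w (inr (B, L))).
Notation V := (Coord n m -> R).

Definition xunit (e : 'I_l -> V) :=
  forall a b, e a (inl (inl (widen_ord hln b))) = (a == b)%:R.

(** If [v] is in the polar space, its difference from the [jspan] vector with the same x-part lies
    in the symbol, and the pairings with the x-parts of the e_L are values Omega(v, e_L) = 0, so the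
    difference vanishes. *)
Lemma polar_jspan z (e : 'I_l -> V) : U (Fproj z) -> frame_nonchar hkl F z e ->
  xunit e -> integral_element F z e ->
  exists q, forall v, polar F z e v <-> v = jspan z q (fun i => v (inl (inl i))).
Proof.
move=> Uz nc ex /integral_elementE [hf heta hdf hOm].
have [|q [qs qD qe]] := frame_jet hF hsolv Uz nc hf heta hdf.
  by move=> A a b _ _; exact: hOm.
exists q => v; rewrite (polarP v hf heta hdf hOm ex); split.
  move=> [veta vdf vOm]; apply: eq_jspan => // p.
  apply: (nc _ (in_symbol_sub_jspan hF Uz veta qD vdf)) => A L.
  rewrite -(Omega_sub A (e (frame_index hkl L))); last by move=> i; rewrite jspan_x.
  by rewrite vOm {1}qe Omega_jspan // subrr.
move=> ->; split=> [A|A al|A a]; first exact: eta_jspan.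
  by apply: (df_jspan hF) => // i; exact: qD.
by rewrite (qe a) Omega_jspan.
Qed.

(** Both spaces are graphs over the x-coordinates, so an independent family is carried from one to
    the other by keeping its x-parts. *)
Lemma has_indep_jspan z z' q q' (H H' : V -> Prop) d :
  (forall v, H v -> v = jspan z q (fun i => v (inl (inl i)))) ->
  (forall v, v = jspan z' q' (fun i => v (inl (inl i))) -> H' v) ->
  has_indep H d -> has_indep H' d.
Proof.
move=> hH hH' [w [wH wi]].
exists (fun j => jspan z' q' (fun i => w j (inl (inl i)))); split=> [j|c hc].
  by apply: hH'; congr (jspan z' q' _); apply: funext => i; rewrite jspan_x.
apply: wi => s; under eq_bigr do rewrite (hH _ (wH _)) /jspan mulr_sumr.
rewrite exchange_big big1 // => i _.
have e : \sum_(j < d) c j * w j (inl (inl i)) = 0.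
  by rewrite -[RHS](hc (inl (inl i))); apply: eq_bigr => j _; rewrite jspan_x.
by under eq_bigr do rewrite mulrA; rewrite -mulr_suml e mul0r.
Qed.

Lemma polar_same_dim z z' (e e' : 'I_l -> V) :
  U (Fproj z) -> frame_nonchar hkl F z e -> xunit e -> integral_element F z e ->
  U (Fproj z') -> frame_nonchar hkl F z' e' -> xunit e' -> integral_element F z' e' ->
  same_dim (polar F z e) (polar F z' e').
Proof.
move=> Uz nc ex he Uz' nc' ex' he' d.
have [q hq] := polar_jspan Uz nc ex he; have [q' hq'] := polar_jspan Uz' nc' ex' he'.
by split; apply: has_indep_jspan => v /=; rewrite ?hq ?hq'; apply.
Qed.

End PolarSpace.

(** * The family in the chart: derivatives, independence and regularity *)

Section Chart.
Variables (R : realType) (n m k l : nat).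
Hypotheses (hkl : (k <= l)%N) (hkn : (k < n)%N).
Variable U : (FCoord n m k -> R) -> Prop.
Variable F : 'I_m -> Gidx n k -> (FCoord n m k -> R) -> R.
Hypothesis hF : forall A al, real_analytic_on U (F A al).
Notation V := (Coord n m -> R).
Implicit Types (t : XCoord n m l -> R) (A B : 'I_m) (al : Gidx n k) (a b : 'I_l).

Definition shift_coord t (tau : XCoord n m l) (e : R) : XCoord n m l -> R :=
  fun s => t s + e * (if s == tau then 1 else 0).

Local Notation cpp a B j := (@inr (Coord n m) (ChartC n m l) (inr (a, (B, j)))).
Local Notation cp a B := (@inr (Coord n m) (ChartC n m l) (inl (inr (a, B)))).

Definition vunit (s0 : Coord n m) : V := fun s => if s == s0 then 1 else 0.

Lemma zof_shift t tau e : zof (shift_coord t (inr tau) e) = zof t.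
Proof. by apply: funext => s; rewrite /zof /shift_coord /= mulr0 addr0. Qed.

Lemma etilde_shift_cpp t a0 B j e a : etilde (shift_coord t (cpp a0 B j) e) a =
  (fun s => e * (if a == a0 then vunit (inr (B, j)) s else 0) + etilde t a s).
Proof.
apply: funext => -[[i|A]|[A i]] /=; rewrite /shift_coord /vunit /=.
- rewrite if_same mulr0 add0r; case: eqP => // _; case: insub => // b.
  by rewrite ?mulr0 addr0.
- by rewrite if_same !mulr0 addr0 add0r.
rewrite [RHS]addrC; congr (_ + e * _).
rewrite -[inr (inr _) == _]/((a, (A, i)) == (a0, (B, j))) xpair_eqE.
by case: eqP.
Qed.

Lemma etilde_shift_cp t a0 B e a : etilde (shift_coord t (cp a0 B) e) a =
  (fun s => e * (if a == a0 then vunit (inl (inr B)) s else 0) + etilde t a s).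
Proof.
apply: funext => -[[i|A]|[A i]] /=; rewrite /shift_coord /vunit /=.
- rewrite if_same mulr0 add0r; case: eqP => // _; case: insub => // b.
  by rewrite ?mulr0 addr0.
- rewrite [RHS]addrC; congr (_ + e * _).
  rewrite -[inr (inl _) == _]/((a, A) == (a0, B)) xpair_eqE.
  by case: eqP.
by rewrite if_same !mulr0 addr0 add0r.
Qed.

(** Only the coordinates c^A_{aj}, c^A_a and p^A_alpha are varied, and the functions differentiated
    along each of them are affine in it. Second derivatives of [F], which enter when [df] is varied
    in [z], thus never occur. *)
Lemma pderiv_affine (f : (XCoord n m l -> R) -> R) tau t (c d : R) :
  (forall e, f (shift_coord t tau e) = c + e * d) -> pderiv f tau t = d.
Proof.
move=> h; rewrite /pderiv /dirderiv -[RHS](derive1_affine c d); congr (derive1 _ 0).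
by apply: funext => e; rewrite -h.
Qed.

Lemma pderiv_f_cpp t a0 B j A al : pderiv (fam F (inl (inl (A, al)))) (cpp a0 B j) t = 0.
Proof.
apply: (@pderiv_affine _ _ _ (fz F A al (zof t))) => e /=.
by rewrite zof_shift mulr0 addr0.
Qed.

Lemma pderiv_eta_cpp t a0 B j A a :
  pderiv (fam F (inl (inr (A, a)))) (cpp a0 B j) t = 0.
Proof.
apply: (@pderiv_affine _ _ _ (eta (zof t) A (etilde t a))) => e /=.
rewrite zof_shift etilde_shift_cpp mulr0 addr0 /eta /dp /dx /vunit /= if_same mulr0 add0r.
by congr (_ - _); apply: eq_bigr => i _; rewrite ?if_same ?mulr0 ?add0r.
Qed.

Lemma pderiv_df_cpp t a0 B j A al a : U (Fproj (zof t)) ->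
  pderiv (fam F (inr (inl (A, al, a)))) (cpp a0 B j) t =
  if a == a0 then df F (zof t) A al (vunit (inr (B, j))) else 0.
Proof.
move=> Ut; apply: (@pderiv_affine _ _ _ (df F (zof t) A al (etilde t a))) => e /=.
rewrite zof_shift etilde_shift_cpp (df_lin hF) // addrC; congr (_ + e * _).
case: eqP => // _.
have -> : (fun=> 0) = vert (fun=> 0) :> V by apply: funext => -[].
by rewrite (df_vert hF) // big1 ?subr0 // => s _; rewrite mulr0.
Qed.

Lemma pderiv_Omega_cpp t a0 B j A a b :
  pderiv (fam F (inr (inr (A, a, b)))) (cpp a0 B j) t =
  (if (a == a0) && (A == B) then etilde t b (inl (inl j)) else 0) -
  (if (b == a0) && (A == B) then etilde t a (inl (inl j)) else 0).
Proof.
apply: (@pderiv_affine _ _ _ (Omega A (etilde t a) (etilde t b))) => e /=.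
rewrite !etilde_shift_cpp /Omega.
have sel (c : bool) (y : 'I_n -> R) :
    \sum_i (if c then vunit (inr (B, j)) (inr (A, i)) else 0) * y i =
    if c && (A == B) then y j else 0.
  case: c => /=; last by rewrite big1 // => i _; rewrite mul0r.
  case: (A =P B) => [->|ne]; last first.
    by rewrite big1 // => i _; rewrite /vunit; case: eqP => [[]//|_]; rewrite mul0r.
  rewrite -(sum_delta y j); apply: eq_bigr => i _; rewrite mulrC /vunit.
  by rewrite -[inr _ == _]/((B, i) == (B, j)) xpair_eqE eqxx.
rewrite -(sel (a == a0) (fun i => etilde t b (inl (inl i)))).
rewrite -(sel (b == a0) (fun i => etilde t a (inl (inl i)))).
rewrite -sumrB mulr_sumr -big_split; apply: eq_bigr => i _.
rewrite /dpp /dx (_ : vunit (inr (B, j)) (inl (inl i)) = 0) // !if_same mulr0 !add0r.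
move: (if a == a0 then _ else _) (if b == a0 then _ else _) => u w.
by move: (etilde t a) (etilde t b) => ea eb /=; ring.
Qed.

Lemma pderiv_f_cp t a0 B A al : pderiv (fam F (inl (inl (A, al)))) (cp a0 B) t = 0.
Proof.
apply: (@pderiv_affine _ _ _ (fz F A al (zof t))) => e /=.
by rewrite zof_shift mulr0 addr0.
Qed.

Lemma pderiv_eta_cp t a0 B A a :
  pderiv (fam F (inl (inr (A, a)))) (cp a0 B) t = ((a == a0) && (A == B))%:R.
Proof.
apply: (@pderiv_affine _ _ _ (eta (zof t) A (etilde t a))) => e /=.
rewrite zof_shift etilde_shift_cp /eta.
have -> : \sum_(i < n) zpp (zof t) A i * dx i (fun s =>
    e * (if a == a0 then vunit (inl (inr B)) s else 0) + etilde t a s) =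
  \sum_(i < n) zpp (zof t) A i * dx i (etilde t a).
  by apply: eq_bigr => i _; rewrite /dx /vunit if_same mulr0 add0r.
rewrite {1}/dp /vunit -[inl (inr A) == _]/(A == B) /dp; case: (a == a0); case: (A == B) => /=; ring.
Qed.

Lemma pderiv_f_p t A0 (al0 : Gidx n k) A al :
  pderiv (fam F (inl (inl (A, al)))) (inl (inr (A0, val al0))) t = ((A == A0) && (al == al0))%:R.
Proof.
apply: (@pderiv_affine _ _ _ (fz F A al (zof t))) => e /=.
rewrite /fz /zpp.
have -> : Fproj (k := k) (zof (shift_coord t (inl (inr (A0, val al0))) e)) = Fproj (zof t).
  apply: funext => -[[i|B]|[B L]] /=; rewrite /zx /zp /zpp /zof /shift_coord /= ?mulr0 ?addr0 //.
  case: eqP => [[_ h]|_]; last by rewrite mulr0 addr0.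
  have hk : (k <= sval al0)%N := valP al0; have hL : (sval L < k)%N := valP L.
  by move: hk; rewrite -h leqNgt hL.
have -> : zof (shift_coord t (inl (inr (A0, val al0))) e) (inr (A, val al)) =
    zof t (inr (A, val al)) + e * ((A == A0) && (al == al0))%:R.
  rewrite /zof /shift_coord; congr (_ + e * _).
  by rewrite -[inl (inr _) == _]/((A, val al) == (A0, val al0)) xpair_eqE val_eqE; case: (_ && _).
by ring.
Qed.

Definition independent_eqs : {set FamIdx n m k l} :=
  [set s : FamIdx n m k l | match s with
   | inr (inr (_, a, b)) => (b < k)%N && (b < a)%N
   | _ => true end].

Lemma vunit_vert B (j : 'I_n) : vunit (inr (B, j)) = vert (fun p => if p == (B, j) then 1 else 0).
Proof. by apply: funext => -[s|p] //; rewrite /vunit. Qed.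

Section Independence.
Variables (t : XCoord n m l -> R) (mu : FamIdx n m k l -> R).
Hypothesis Ut : U (Fproj (zof t)).
Hypothesis nc : frame_nonchar hkl F (zof t) (etilde t).
Hypothesis hmu : forall tau, \sum_(s in independent_eqs) mu s * pderiv (fam F s) tau t = 0.

Lemma relation_along_symbol a0 (W : 'I_m * 'I_n -> R) :
  \sum_(s in independent_eqs) mu s * \sum_p W p * pderiv (fam F s) (cpp a0 p.1 p.2) t = 0.
Proof.
under eq_bigr do rewrite mulr_sumr.
rewrite exchange_big big1 // => p _ /=.
rewrite (eq_bigr (fun s => W p * (mu s * pderiv (fam F s) (cpp a0 p.1 p.2) t))).
  by rewrite -mulr_sumr hmu mulr0.
by move=> s _; rewrite mulrCA.
Qed.

(* Descending induction on [a]: moving [e_a] along a symbol direction [W] also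
   changes [Omega(e_a', e_a)] for [a' > a], whose multipliers vanish already. *)
Lemma relation_Omega0 A a b : (b < k)%N -> (b < a)%N -> mu (inr (inr (A, a, b))) = 0.
Proof.
have [d] := ubnP (l - a); elim: d A a b => // d IH A a b had bk ba.
have [L0 eL0] := frame_index_surj hkl hkn bk.
(* This direction is dual to the sought multiplier: it pairs to 1 with e_b in component A and to 0
   with the other e_Lambda and components. Being in the symbol it also annihilates the [df] terms,
   while [fz] and [eta] do not involve c^A_{aj}. *)
have [W [Wsym Wp]] := pairing_surjective (fun A al c u v => df_lin hF A al c u v Ut)
  (fun A al W => df_vert hF A al W Ut) nc (fun B L => if (B == A) && (L == L0) then 1 else 0).
have Wb B (c : 'I_l) : (c < k)%N -> pairing W (frame_x (etilde t) c) B = ((B == A) && (c == b))%:R.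
  move=> ck; have [L eL] := frame_index_surj hkl hkn ck; rewrite -eL Wp -eL0.
  have -> : (frame_index hkl L == frame_index hkl L0) = (L == L0).
    by rewrite -!val_eqE.
  by case: (_ && _).
have sumOm B c c' : \sum_p W p * pderiv (fam F (inr (inr (B, c, c')))) (cpp a p.1 p.2) t =
  (if c == a then pairing W (frame_x (etilde t) c') B else 0) -
  (if c' == a then pairing W (frame_x (etilde t) c) B else 0).
  under eq_bigr do rewrite pderiv_Omega_cpp mulrBr.
  have sel (cond : bool) (y : 'I_n -> R) :
     \sum_(p : 'I_m * 'I_n) W p * (if cond && (B == p.1) then y p.2 else 0) =
     if cond then pairing W y B else 0.
    case: cond => /=; last by rewrite big1 // => p _; rewrite mulr0.
    rewrite (eq_bigr (fun p => W (p.1, p.2) * (if B == p.1 then y p.2 else 0))); last by case.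
    rewrite -(pair_bigA _ (fun B' j => W (B', j) * (if B == B' then y j else 0))) /=.
    rewrite (bigD1 B) //= [X in _ + X]big1 ?addr0 => [|B' hB].
      by apply: eq_bigr => j _; rewrite eqxx.
    by rewrite big1 // => j _; rewrite eq_sym (negbTE hB) mulr0.
  by rewrite sumrB !(sel _ (fun j => etilde t _ (inl (inl j)))).
have := relation_along_symbol a W; rewrite (bigD1 (inr (inr (A, a, b)))) /=; last by rewrite inE bk.
rewrite sumOm eqxx Wb // !eqxx (_ : (b == a) = false); last first.
  by apply/eqP => e; rewrite e ltnn in ba.
rewrite subr0 mulr1 big1 ?addr0 // => -[[[B al]|[B c]]|[[[B al] c]|[[B c] c']]] /andP[hs ne].
- by rewrite big1 ?mulr0 // => p _; rewrite pderiv_f_cpp mulr0.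
- by rewrite big1 ?mulr0 // => p _; rewrite pderiv_eta_cpp mulr0.
- under eq_bigr do rewrite pderiv_df_cpp //.
  case: (c == a); last by rewrite big1 ?mulr0 // => p _; rewrite mulr0.
  rewrite -(functional_sum (f := df F (zof t) B al)); last first.
    by move=> *; exact: (df_lin hF).
  rewrite (_ : (fun s => _) = vert W) ?Wsym ?mulr0 //.
  apply: funext => -[s|p] /=.
    by rewrite big1 // => p _; rewrite /vunit mulr0.
  rewrite (eq_bigr (fun p' => W p' * (if p' == p then 1 else 0))) ?sum_delta // => -[B' j] _.
  by rewrite vunit_vert /= eq_sym.
- rewrite sumOm; move: hs; rewrite inE => /andP[c'k c'c].
  case: (c' =P a) => [e|_].
    rewrite IH ?mul0r //; have := ltn_ord c; rewrite e in c'c.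
    by move: had c'c; lia.
  rewrite subr0; case: (c =P a) => [e|_]; last by rewrite mulr0.
  rewrite Wb //; case: eqP => [eB|_]; case: eqP => [eb|_]; rewrite ?mulr0 //.
  by rewrite e eB eb eqxx in ne.
Qed.

(** With the [Omega] multipliers gone the relation is triangular: c^A_{a alpha} isolates [df], since
    [F] does not involve p_alpha; then c^A_a isolates [eta], and finally p^A_alpha isolates [fz]. *)
Lemma relation_df0 A al a : mu (inr (inl (A, al, a))) = 0.
Proof.
have := hmu (cpp a A (val al)); rewrite (bigD1 (inr (inl (A, al, a)))) /=; last by rewrite inE.
have dfE B be : df F (zof t) B be (vunit (inr (A, val al))) = ((B == A) && (be == al))%:R.
  rewrite vunit_vert (df_vert hF) // big1 => [|[B' L] _].
    by rewrite subr0 xpair_eqE val_eqE; case: (_ && _).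
  rewrite /= xpair_eqE; case: eqP => [_|_]; last by rewrite mulr0.
  case: eqP => [h|_]; last by rewrite mulr0.
  have hk : (k <= sval al)%N := valP al; have hL : (sval L < k)%N := valP L.
  by move: hk; rewrite -[sval al]h leqNgt hL.
rewrite pderiv_df_cpp // eqxx dfE !eqxx mulr1.
rewrite big1 ?addr0 // => -[[[B be]|[B c]]|[[[B be] c]|[[B c] c']]] /andP[hs ne].
- by rewrite pderiv_f_cpp mulr0.
- by rewrite pderiv_eta_cpp mulr0.
- rewrite pderiv_df_cpp // dfE; case: eqP => [e1|_]; last by rewrite mulr0.
  case: eqP => [e2|_]; case: eqP => [e3|_]; rewrite ?mulr0 //.
  by rewrite e1 e2 e3 eqxx in ne.
- by move: hs; rewrite inE => /andP[h1 h2]; rewrite relation_Omega0 ?mul0r.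
Qed.

Lemma relation_eta0 A a : mu (inl (inr (A, a))) = 0.
Proof.
have := hmu (cp a A); rewrite (bigD1 (inl (inr (A, a)))) /=; last by rewrite inE.
rewrite pderiv_eta_cp !eqxx mulr1.
rewrite big1 ?addr0 // => -[[[B be]|[B c]]|[[[B be] c]|[[B c] c']]] /andP[hs ne].
- by rewrite pderiv_f_cp mulr0.
- rewrite pderiv_eta_cp; case: eqP => [e1|_]; case: eqP => [e2|_]; rewrite ?mulr0 //.
  by rewrite e1 e2 eqxx in ne.
- by rewrite relation_df0 mul0r.
- by move: hs; rewrite inE => /andP[h1 h2]; rewrite relation_Omega0 ?mul0r.
Qed.

Lemma relation_f0 A al : mu (inl (inl (A, al))) = 0.
Proof.
have := hmu (inl (inr (A, val al))); rewrite (bigD1 (inl (inl (A, al)))) /=; last by rewrite inE.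
rewrite pderiv_f_p !eqxx mulr1.
rewrite big1 ?addr0 // => -[[[B be]|[B c]]|[[[B be] c]|[[B c] c']]] /andP[hs ne].
- rewrite pderiv_f_p; case: eqP => [e1|_]; case: eqP => [e2|_]; rewrite ?mulr0 //.
  by rewrite e1 e2 eqxx in ne.
- by rewrite relation_eta0 mul0r.
- by rewrite relation_df0 mul0r.
- by move: hs; rewrite inE => /andP[h1 h2]; rewrite relation_Omega0 ?mul0r.
Qed.

Lemma relation_trivial s : s \in independent_eqs -> mu s = 0.
Proof.
case: s => [[[B be]|[B c]]|[[[B be] c]|[[B c] c']]] hs.
- exact: relation_f0.
- exact: relation_eta0.
- exact: relation_df0.
- by move: hs; rewrite inE => /andP[h1 h2]; rewrite relation_Omega0.
Qed.

End Independence.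

Hypothesis hsolv : forall w, U w ->
     approx_solvable F (fun i => w (inl (inl i))) (fun B => w (inl (inr B)))
                       (fun B L => w (inr (B, L))).

(** The two conditions on a point of the chart that persist in a neighbourhood of the given element;
    see [admissible_near]. *)
Definition admissible t := U (Fproj (zof t)) /\ frame_nonchar hkl F (zof t) (etilde t).

Lemma fam_zero_jet t : admissible t -> (forall s, s \in independent_eqs -> fam F s t = 0) ->
  exists q, [/\ forall A, symmetric_array (q A),
    forall i A al, df F (zof t) A al (lift_dx (zof t) q i) = 0 &
    forall a, etilde t a = jspan (zof t) q (frame_x (etilde t) a)].
Proof.
move=> [Ut nc] h; apply: (frame_jet hF hsolv Ut nc).
- by move=> A al; apply: (h (inl (inl (A, al)))); rewrite inE.
- by move=> A a; apply: (h (inl (inr (A, a)))); rewrite inE.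
- by move=> A al a; apply: (h (inr (inl (A, al, a)))); rewrite inE.
- by move=> A a b bk ba; apply: (h (inr (inr (A, a, b)))); rewrite inE bk.
Qed.

Lemma fam_zero_of_independent_eqs t : admissible t -> (forall s, s \in independent_eqs -> fam F s t = 0) ->
  forall s, fam F s t = 0.
Proof.
move=> gt h; have [q [qs _ qe]] := fam_zero_jet gt h.
case=> [s|[s|[[A a] b]]]; [by apply: h; rewrite inE|by apply: h; rewrite inE|].
by rewrite /fam (qe a) (qe b) Omega_jspan.
Qed.

Lemma fam_zero_integral t : integral_element F (zof t) (etilde t) -> forall s, fam F s t = 0.
Proof.
move=> /integral_elementE [h1 h2 h3 h4].
by move=> [[[A al]|[A a]]|[[[A al] a]|[[A a] b]]] /=.
Qed.

(** A basis vector with 0-based index [n] would have zero x-part; as a [jspan] vector it would then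
    be zero, against linear independence. *)
Lemma integral_dim_le t : admissible t -> integral_element F (zof t) (etilde t) -> (l <= n)%N.
Proof.
move=> gt hi; rewrite leqNgt; apply/negP => nl.
have [q [_ _ qe]] := fam_zero_jet gt (fun s _ => fam_zero_integral hi s).
pose a : 'I_l := Ordinal nl.
have x0 i : frame_x (etilde t) a i = 0.
  rewrite /frame_x /=; case: eqP => [e|_]; first by have := ltn_ord i; rewrite e ltnn.
  by case: insubP => // b hb; have := leq_trans nl (leq_trans hb (ltnW (ltn_ord i))); rewrite ltnn.
have [li _] := hi.
have := li (fun j => if j == a then 1 else 0) _ a; rewrite eqxx => h.
have /eqP := oner_neq0 R; apply; apply: h => s.
under eq_bigr do rewrite mulrC.
rewrite (sum_delta (fun j => etilde t j s)) qe /jspan big1 // => i _.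
by rewrite x0 mul0r.
Qed.

Lemma xunit_etilde (hln : (l <= n)%N) t : xunit hln (etilde t).
Proof.
move=> a b /=; rewrite eq_sym -[nat_of_ord a == nat_of_ord b]/(a == b).
case: eqP => // _; case: insubP => // c hc.
by have := ltn_ord b; rewrite ltnNge hc.
Qed.

Lemma kahler_regular_admissible t r : 0 < r -> (forall t', dmax t' t < r -> admissible t') ->
  integral_element F (zof t) (etilde t) -> kahler_regular F t.
Proof.
move=> r0 hgood hi.
have gt : admissible t by apply: hgood; rewrite dmaxxx.
have hln := integral_dim_le gt hi.
split.
  split=> //; split; first exact: fam_zero_integral.
  exists independent_eqs; split; first by move=> mu hmu s; case: gt => Ut nc; exact: (relation_trivial Ut nc hmu).
  exists r; split=> // t' ht'; split=> [h s _|h]; first exact: h.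
  by apply: fam_zero_of_independent_eqs => //; exact: hgood.
exists r; split=> // t' ht' hi'.
have [Ut' nc'] := hgood _ ht'; have [Ut nc] := gt.
by apply: (polar_same_dim hF hsolv Ut' nc' (xunit_etilde hln t') hi' Ut nc (xunit_etilde hln t)).
Qed.

End Chart.

(** * Uniform estimates near the given integral element *)

Lemma symbol_locally_bounded (R : realType) (n m k : nat)
    (U : (FCoord n m k -> R) -> Prop)
    (F : 'I_m -> Gidx n k -> (FCoord n m k -> R) -> R) w :
  (forall A al, real_analytic_on U (F A al)) -> U w ->
  exists C rho : R, [/\ 0 <= C, 0 < rho &
    forall A al s w', dmax w' w < rho -> `|pderiv (F A al) s w'| <= C].
Proof.
move=> hF Uw.
have /choice [C hC] := fun p : 'I_m * Gidx n k => pderiv_locally_bounded (hF p.1 p.2) Uw.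
have C0 p : 0 <= C p by have [? []] := hC p.
have [|r [r0 hr]] := @finite_radius R ('I_m * Gidx n k)%type
  (fun p t => forall w' s, dmax w' w <= t -> `|pderiv (F p.1 p.2) s w'| <= C p).
  move=> p; have [rho [_ rho0 h]] := hC p; exists rho; split=> // t t0 tr w' s hw.
  by apply: h; apply: le_trans hw (ltW tr).
exists (\sum_p C p), (r / 2); split; [exact: sumr_ge0|by rewrite divr_gt0|].
move=> A al s w' hw.
have hr2 : 0 < r / 2 by rewrite divr_gt0.
have := hr (r / 2) hr2 _ (A, al) w' s (ltW hw) => /= h.
apply: le_trans (h _) _; first by lra.
by rewrite (bigD1 (A, al)) //= lerDl sumr_ge0.
Qed.

(** Since c^b_a = 0 at [t0], the x-parts of e_1, ..., e_k deviate from the coordinate frame by at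
    most the distance to [t0], and the coefficients of the symbol stay bounded. *)
Lemma admissible_near (R : realType) (n m k l : nat) (hkl : (k <= l)%N)
    (U : (FCoord n m k -> R) -> Prop)
    (F : 'I_m -> Gidx n k -> (FCoord n m k -> R) -> R) (t0 : XCoord n m l -> R) :
  (forall A al, real_analytic_on U (F A al)) ->
  open_set U -> U (Fproj (zof t0)) ->
  (forall a b, t0 (inr (inl (inl (a, b)))) = 0) ->
  exists r : R, 0 < r /\ forall t, dmax t t0 < r -> admissible hkl U F t.
Proof.
move=> hF Uo Ut0 hc0.
have [rU [rU0 hU]] := Uo _ Ut0.
have [C [rho [C0 rho0 hC]]] := symbol_locally_bounded hF Ut0.
set K : R := (#|{: 'I_m * Lidx n k}|)%:R * (n%:R * (1 + C)).
have K0 : 0 <= K by rewrite !mulr_ge0 // addr_ge0.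
have K1 : 0 < K + 1 by rewrite ltr_wpDl.
(* The radius 1 / (K + 1) makes the contraction factor K * [dmax t t0] of [noncharacteristic_small]
   less than 1. *)
exists (Num.min (Num.min rU rho) (K + 1)^-1); split.
  by rewrite !lt_min rU0 rho0 invr_gt0.
move=> t; rewrite !lt_min -andbA => /and3P[tU trho tK].
have dF : dmax (Fproj (zof t)) (Fproj (k := k) (zof t0)) <= dmax t t0.
  apply: dmax_le => [|[[i|B]|[B L]]]; first exact: dmax_ge0.
  - exact: (le_dmax t t0 (inl (inl (inl i)))).
  - exact: (le_dmax t t0 (inl (inl (inr B)))).
  - exact: (le_dmax t t0 (inl (inr (B, val L)))).
have Ut : U (Fproj (zof t)) by apply: hU; exact: le_lt_trans dF tU.
split=> //; rewrite /frame_nonchar.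
apply: (noncharacteristic_small (fun A al W => df_vert hF A al W Ut) C0 (dmax_ge0 t t0)).
- by move=> A al s; apply: hC; exact: le_lt_trans dF trho.
- move=> L i; rewrite /frame_x /=.
  case: (i =P val L) => [->|ne]; first by rewrite eqxx subrr normr0 dmax_ge0.
  case: eqP => [e|_]; first by case: ne; exact: val_inj.
  rewrite subr0; case: insubP => [b _ _|_]; last by rewrite normr0 dmax_ge0.
  by have := le_dmax t t0 (inr (inl (inl (frame_index hkl L, b)))); rewrite hc0 subr0.
have -> : (#|{: 'I_m * Lidx n k}|)%:R * (n%:R * (dmax t t0 * (1 + C))) = K * dmax t t0.
  by rewrite /K; ring.
apply: le_lt_trans (ler_wpM2l K0 (ltW tK)) _.
by rewrite ltr_pdivrMr // mul1r ltrDl.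
Qed.

Theorem theorem6p1 (R : realType) (n m k l : nat)
  (hk : (0 < k)%N) (hkn : (k < n)%N) (hm : (0 < m)%N)
  (U : (FCoord n m k -> R) -> Prop)
  (F : 'I_m -> Gidx n k -> (FCoord n m k -> R) -> R)
  (hF : forall A al, real_analytic_on U (F A al))
  (hsolv : forall w : FCoord n m k -> R, U w ->
     approx_solvable F (fun i => w (inl (inl i))) (fun B => w (inl (inr B)))
                       (fun B L => w (inr (B, L))))
  (hkl : (k <= l)%N)
  (z0 : Coord n m -> R)
  (hz0U : U (Fproj z0))
  (hz0F : forall A (al : Gidx n k), zpp z0 A (val al) = F A al (Fproj z0))
  (c0 : ChartC n m l -> R)
  (hc0 : forall a b, c0 (inl (inl (a, b))) = 0)
  (hE0 : integral_element F (zof (fun s => match s with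
                                           | inl s' => z0 s'
                                           | inr s' => c0 s' end))
                            (etilde (fun s => match s with
                                              | inl s' => z0 s'
                                              | inr s' => c0 s' end))) :
  exists r : R, 0 < r /\
    forall t : XCoord n m l -> R,
      dmax t (fun s => match s with inl s' => z0 s' | inr s' => c0 s' end) < r ->
      integral_element F (zof t) (etilde t) ->
      kahler_regular F t.
Proof.
(* Openness of [U] is part of the analyticity of any one component of [F]; the one taken has A = 0
   and alpha = k in 0-based numbering. *)
have Uo : open_set U := proj1 (hF (Ordinal hm) (exist _ (Ordinal hkn) (leqnn k))).
set t0 := (fun s => match s with inl s' => z0 s' | inr s' => c0 s' end).
have [r [r0 hr]] := @admissible_near R n m k l hkl U F t0 hF Uo hz0U hc0.
exists r; split=> // t ht hi.
apply: (@kahler_regular_admissible R n m k l hkl hkn U F hF hsolv t (r - dmax t t0)) hi => //.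
  by rewrite subr_gt0.
move=> t' ht'; apply: hr; apply: le_lt_trans (dmax_triangle t' t t0) _.
by rewrite -ltrBrDr.
Qed.
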